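(* Suppose $f\in F^2$ is not identically zero, and $\theta_{\pm}$ are the angles between $f$ and $f'\pm zf$. Then $$\|f'+zf\|\,\|f'-zf\|\,|\sin(\theta_+)\sin(\theta_-)|\ge\|f\|^2 .$$ Furthermore, equality holds if and only if $$f(z)=C\exp\left(\frac{c-1}{2(c+1)}\,z^2+\frac{a+ibc}{c+1}\,z\right)$$ for some positive $c$, some real $a$ and $b$, and some nonzero complex $C$.
   Context: The Fock space is $F^2=L^2(\mathbb{C},d\lambda)\cap H(\mathbb{C})$, where $H(\mathbb{C})$ is the space of entire functions and $d\lambda(z)=\frac1\pi e^{-|z|^2}dA(z)$ with $dA$ ordinary area measure. It is a Hilbert space with $\langle f,g\rangle=\int_{\mathbb{C}} f\overline{g}\,d\lambda$ and $\|f\|^2=\int_{\mathbb{C}}|f|^2\,d\lambda$. Here $f'$ is the complex derivative, $zf$ denotes the function $z\mapsto zf(z)$, and $i$ is the imaginary unit. The angle $\theta$ between nonzero $f,g\in F^2$ is $\theta\in[0,\pi/2]$ with $\cos\theta=\frac{|\langle g,f\rangle|}{\|g\|\,\|f\|}$. When $f'\notin F^2$ (equivalently $zf\notin F^2$) the left-hand side is regarded as $+\infty$, so the inequality is trivially true (and strict). *)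

(* Defs.v *)
From HB Require Import structures.
From mathcomp Require Import all_boot all_order all_algebra.
From mathcomp Require Import all_classical all_reals all_analysis.
From mathcomp Require Import complex.

Set Implicit Arguments.
Unset Strict Implicit.
Unset Printing Implicit Defensive.

Import Order.TTheory GRing.Theory Num.Theory.
Import numFieldNormedType.Exports.

Local Open Scope classical_set_scope.
Local Open Scope ring_scope.
Local Open Scope complex_scope.

Section Fock.
Variable R : realType.
Implicit Types (f g : R[i] -> R[i]) (z : R[i]).

Definition cabs z : R := Normc.normc z.

Definition cexp z : R[i] :=
  (expR (complex.Re z))%:C * (cos (complex.Im z) +i* sin (complex.Im z)).

(* [derivable] and [derive1] are taken over the scalar field R[i] itself, so
   they are complex differentiability and the complex derivative. *)
Definition entire f : Prop :=
  forall z, derivable (f : R[i]^o -> R[i]^o) z 1.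

Definition cderiv f : R[i] -> R[i] := derive1 (f : R[i]^o -> R[i]^o).

(* The plane with its Borel sigma-algebra; functions on R[i] are measured and
   integrated through the identification [toC]. *)
Local Notation plane := (measurableTypeR R * measurableTypeR R)%type.

Definition toC (p : plane) : R[i] := p.1 +i* p.2.

Definition area : {measure set plane -> \bar R} :=
  (@lebesgue_measure R \x @lebesgue_measure R)%E.

(* The measure d lambda enters through its density: the integral of h against
   d lambda is the area integral of h times [gauss]. *)
Definition gauss z : R := pi^-1 * expR (- (cabs z ^+ 2)).

Definition lambda_int (h : R[i] -> R) : R :=
  \int[area]_p (h (toC p) * gauss (toC p)).

Definition L2_lambda f : Prop :=
  [/\ measurable_fun setT (fun p : plane => complex.Re (f (toC p))),
      measurable_fun setT (fun p : plane => complex.Im (f (toC p))) &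
      (\int[area]_p (cabs (f (toC p)) ^+ 2 * gauss (toC p))%:E < +oo)%E].

Definition fock f : Prop := L2_lambda f /\ entire f.

Definition fock_inner f g : R[i] :=
  lambda_int (fun z => complex.Re (f z * conjc (g z))) +i*
  lambda_int (fun z => complex.Im (f z * conjc (g z))).

Definition fock_norm f : R :=
  Num.sqrt (lambda_int (fun z => cabs (f z) ^+ 2)).

(* For nonzero f and g in the Fock space the argument of [acos] lies in
   [0, 1], so the angle lies in [0, pi / 2]. *)
Definition fock_angle f g : R :=
  acos (cabs (fock_inner g f) / (fock_norm g * fock_norm f)).

Definition deriv_plus f : R[i] -> R[i] := fun z => cderiv f z + z * f z.

Definition deriv_minus f : R[i] -> R[i] := fun z => cderiv f z - z * f z.

(* The product has value +oo when f' (equivalently z f) is not in the Fock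
   space.  For nonzero f in the Fock space, f' + z f and f' - z f are nonzero:
   otherwise f would be a multiple of exp (-+ z ^ 2 / 2), which is not square
   integrable.  Hence both angles are between nonzero functions. *)
Definition uncertainty_lhs f : \bar R :=
  if `[< fock (cderiv f) >] then
    (fock_norm (deriv_plus f) * fock_norm (deriv_minus f) *
     `| sin (fock_angle f (deriv_plus f)) *
        sin (fock_angle f (deriv_minus f)) |)%:E
  else +oo%E.

End Fock.

(* Main.v *)
Require Import Defs.
From mathcomp Require Import all_boot all_order all_algebra.
From mathcomp Require Import all_classical all_reals all_analysis.
From mathcomp Require Import measurable_realfun complex ring lra.

Set Implicit Arguments.
Unset Strict Implicit.
Unset Printing Implicit Defensive.

Import Order.TTheory GRing.Theory Num.Theory.
Import numFieldNormedType.Exports.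

Local Open Scope classical_set_scope.
Local Open Scope ring_scope.
Local Open Scope complex_scope.

(** Let D be differentiation and Z multiplication by z. On the Fock space they are
    adjoint to each other and D Z - Z D = 1, so D + Z is symmetric, D - Z is
    antisymmetric and their commutator is a constant. For real a, b put
    A = f' + z f - a f and B = f' - z f - i b f. The adjunction kills all the cross
    terms with a and b, and

      Re <A, B> = |f'|^2 - |z f|^2 = - |f|^2.

    Hence |A + t B|^2 = |A|^2 + t^2 |B|^2 - 2 t |f|^2 is nonnegative for all real t,
    which gives |A| |B| >= |f|^2. For the best a and b, the vectors A and B are the
    components of f' + z f and f' - z f orthogonal to f, so that their norms are the
    norms of these two functions times the sines of the two angles. Equality means
    that the quadratic in t vanishes at some c > 0, where A + c B = 0: this is the
    equation (1 + c) f' = ((c - 1) z + a + i b c) f, whose solutions are the stated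
    exponentials.

    The analytic part is the identity |z f|^2 = |f'|^2 + |f|^2 ([moment_identity]),
    including the fact that z f is square integrable as soon as f and f' are
    ([integrable_moment]), and the adjunction <f', f> = <f, z f>
    ([adjoint_identity1], [adjoint_identity2]). All of this is done with real
    integration by parts against the Gaussian density, cut off to growing squares.
    The first identity is the formula Lap |f|^2 = 4 |f'|^2 tested against the
    Gaussian, since (1/4) Lap exp (- |z|^2) = (|z|^2 - 1) exp (- |z|^2). The formula is
    proved in weak form ([weak_laplacian]) from the continuity of f' alone: an
    identity that is linear in a holomorphic function g and free of g' is applied to
    the translates g = f (. + h), and then differentiated in h. The cut-off identity
    bounds the truncated moments of f, so that z f is square integrable by Fatou's
    lemma, and the error terms vanish by dominated convergence.

    When f' is not in the Fock space the left-hand side is infinite, and f is none of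
    the exponentials, because a Gaussian estimate ([fock_cderiv_exponential]) puts
    the derivative of such an exponential in the Fock space. *)

Local Notation plane R := (measurableTypeR R * measurableTypeR R)%type.

(** * Integration over squares of the plane *)

Section PlaneMeasure.
Variable R : realType.
Local Notation plane := (plane R).
Implicit Types (F G : R * R -> R) (n : R).

(** An open set is the union of the rectangles with rational corners that it contains,
    and there are countably many of these. *)
Lemma open_measurable_plane (A : set (R * R)) :
  open A -> measurable (A : set plane).
Proof.
move=> oA.
pose box (a b c d : rat) : set plane := `]ratr a, ratr b[ `*` `]ratr c, ratr d[.
pose F a b c d : set plane := if `[< box a b c d `<=` A >] then box a b c d else set0.
have -> : (A : set plane) = \bigcup_a \bigcup_b \bigcup_c \bigcup_d F a b c d.
  apply/seteqP; split => [[x y] Axy|]; last first.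
    move=> p [a _ [b _ [c _ [d _]]]]; rewrite /F.
    by case: ifPn => // /asboolP; apply.
  have : nbhs (x, y) A by apply: open_nbhs_nbhs; split.
  move=> /nbhs_ballP[e /= e0 He].
  have [a /[!in_itv]/= /andP[a1 a2]] := @rat_in_itvoo R (x - e) x ltac:(lra).
  have [b /[!in_itv]/= /andP[b1 b2]] := @rat_in_itvoo R x (x + e) ltac:(lra).
  have [c /[!in_itv]/= /andP[c1 c2]] := @rat_in_itvoo R (y - e) y ltac:(lra).
  have [d /[!in_itv]/= /andP[d1 d2]] := @rat_in_itvoo R y (y + e) ltac:(lra).
  exists a => //; exists b => //; exists c => //; exists d => //.
  rewrite /F; case: ifPn => [_|/asboolP[]].
    by rewrite /box /=; split; rewrite /= in_itv/= ?a2 ?b1 ?c2 ?d1.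
  move=> [x' y'] [/=]; rewrite !in_itv/= => /andP[h1 h2] /andP[h3 h4].
  by apply: He; split; rewrite /ball/= ltr_norml; lra.
do 4 apply: bigcupT_measurable_rat => ?.
rewrite /F; case: ifPn => // _; apply: measurableX; exact: measurable_itv.
Qed.

Lemma continuous_measurable_plane F :
  continuous F -> measurable_fun setT (F : plane -> R).
Proof.
move=> /continuousP cF; apply: (measurability _ (RGenOpens.measurableE R)).
move=> _ [_ [a [b ->] <-]]; rewrite setTI.
apply: open_measurable_plane; apply: cF; exact: interval_open.
Qed.

Definition square n : set (R * R) := `[- n, n] `*` `[- n, n].

Lemma squareE n (p : R * R) : square n p <-> `|p.1| <= n /\ `|p.2| <= n.
Proof. by rewrite /square /= !in_itv /= -!ler_norml. Qed.

Lemma measurable_square n : measurable (square n : set plane).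
Proof. by apply: measurableX; exact: measurable_itv. Qed.

Lemma bounded_square F n : continuous F ->
  exists2 M, 0 <= M & forall p, square n p -> `|F p| <= M.
Proof.
move=> cF.
have csq : compact (square n).
  exact: (compact_setX (@segment_compact _ _ _) (@segment_compact _ _ _)).
have cFs : compact (F @` square n : set R^o).
  apply: continuous_compact => //.
  exact: continuous_subspaceT.
have [M [_ HM]] := compact_bounded cFs.
exists (`|M| + 1); first by rewrite addr_ge0.
move=> p sp; apply: HM; last by exists p.
by rewrite ltr_pwDr// ler_norm.
Qed.

Local Notation leb := (@lebesgue_measure R).

Lemma area_rectangle (A B : set (measurableTypeR R)) :
  measurable A -> measurable B ->
  area R (A `*` B) = (leb A * leb B)%E.
Proof. by move=> mA mB; exact: product_measure1E. Qed.

Lemma area_fubini_xy (f : plane -> \bar R) : (area R).-integrable setT f ->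
  (\int[area R]_p f p = \int[leb]_x \int[leb]_y f (x, y))%E.
Proof. by move=> fi; exact: esym (integral12_prod_meas1 fi). Qed.

Lemma area_fubini_yx (f : plane -> \bar R) : (area R).-integrable setT f ->
  (\int[area R]_p f p = \int[leb]_y \int[leb]_x f (x, y))%E.
Proof. by move=> fi; exact: esym (integral21_prod_meas1 fi). Qed.

Lemma area_square n : (area R (square n) < +oo)%E.
Proof.
rewrite area_rectangle; [|exact: measurable_itv..].
by rewrite /= !lebesgue_measure_itv/=; case: ifP => _; rewrite ?mule0 ?ltry// -EFinB -EFinM ltry.
Qed.

Lemma continuous_square_integrable F n : continuous F ->
  (area R).-integrable (square n) (EFin \o F).
Proof.
move=> cF; apply: measurable_bounded_integrable.
- exact: measurable_square.
- exact: area_square.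
- by apply: measurable_funTS; exact: continuous_measurable_plane.
- have [M _ HM] := bounded_square n cF.
  exists M; split; rewrite ?num_real // => x Mx p sp /=.
  by rewrite (le_trans (HM _ sp))// ltW.
Qed.

Lemma square_integral_xy F n : continuous F ->
  (\int[area R]_(p in square n) (F p)%:E =
   \int[lebesgue_measure]_(x in `[(- n)%R, n]%classic)
     \int[lebesgue_measure]_(y in `[(- n)%R, n]%classic) (F (x, y))%:E)%E.
Proof.
move=> cF; rewrite integral_mkcond.
have /(integrable_mkcond _ (measurable_square n)) iF :=
  continuous_square_integrable n cF.
rewrite area_fubini_xy// [RHS]integral_mkcond.
apply: eq_integral => x _; rewrite patchE; case: ifPn => xn.
  rewrite [RHS]integral_mkcond; apply: eq_integral => y _.
  by rewrite !patchE in_setX/= xn.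
by apply: integral0_eq => y _; rewrite !patchE in_setX/= (negbTE xn).
Qed.

Lemma square_integral_yx F n : continuous F ->
  (\int[area R]_(p in square n) (F p)%:E =
   \int[lebesgue_measure]_(y in `[(- n)%R, n]%classic)
     \int[lebesgue_measure]_(x in `[(- n)%R, n]%classic) (F (x, y))%:E)%E.
Proof.
move=> cF; rewrite integral_mkcond.
have /(integrable_mkcond _ (measurable_square n)) iF :=
  continuous_square_integrable n cF.
rewrite area_fubini_yx// [RHS]integral_mkcond.
apply: eq_integral => y _; rewrite patchE; case: ifPn => yn.
  rewrite [RHS]integral_mkcond; apply: eq_integral => x _.
  by rewrite !patchE in_setX/= yn andbT.
by apply: integral0_eq => x _; rewrite !patchE in_setX/= (negbTE yn) andbF.
Qed.

Definition partial1 F Fx := forall x y : R,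
  is_derive x (1 : R) (fun t => F (t, y)) (Fx (x, y)).
Definition partial2 F Fy := forall x y : R,
  is_derive y (1 : R) (fun t => F (x, t)) (Fy (x, y)).

Lemma continuous_pair (T : topologicalType) F (f g : T -> R) :
  continuous F -> continuous f -> continuous g ->
  continuous (fun t => F (f t, g t)).
Proof.
move=> cF cf cg t.
apply: (@continuous2_cvg _ _ _ _ _ _ f g (fun a b => F (a, b))); [|exact: cf|exact: cg].
by under eq_fun do rewrite -surjective_pairing; exact: cF.
Qed.

Lemma continuous_line1 F (y : R) : continuous F -> continuous (fun x => F (x, y)).
Proof. by move=> cF; apply: continuous_pair => // x; [exact: cvg_id|exact: cvg_cst]. Qed.

Lemma continuous_line2 F (x : R) : continuous F -> continuous (fun y => F (x, y)).
Proof. by move=> cF; apply: continuous_pair => // y; [exact: cvg_cst|exact: cvg_id]. Qed.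

Lemma integral_derivative_vanishing (f g : R -> R) n : 0 < n ->
  continuous g -> (forall x, is_derive x (1 : R) f (g x)) ->
  f (- n) = 0 -> f n = 0 ->
  (\int[lebesgue_measure]_(x in `[(- n)%R, n]%classic) (g x)%:E = 0)%E.
Proof.
move=> n0 cg df fa fb.
have cf : continuous f.
  move=> x; apply: differentiable_continuous; apply/derivable1_diffP.
  exact: (@ex_derive _ _ _ _ _ _ _ (df x)).
rewrite (@continuous_FTC2 _ g f) ?fa ?fb ?subee//.
- by rewrite gtrN.
- exact: continuous_subspaceT.
- split.
  + by move=> x _; apply: (@ex_derive _ _ _ _ _ _ _ (df x)).
  + by apply: cvg_at_right_filter; exact: cf.
  + by apply: cvg_at_left_filter; exact: cf.
- by move=> x _; rewrite derive1E; apply: (@derive_val _ _ _ _ _ _ _ (df x)).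
Qed.

(** Fubini, integrating first along the direction of the derivative, and then the
    fundamental theorem of calculus on each line. *)
Lemma square_integral_partial1 F Fx n : 0 < n -> continuous Fx -> partial1 F Fx ->
  (forall p, `|p.1| = n -> F p = 0) ->
  \int[area R]_(p in square n) Fx p = 0.
Proof.
move=> n0 cFx dF F0; rewrite /Rintegral square_integral_yx//.
rewrite integral0_eq// => y _.
apply: (@integral_derivative_vanishing (fun x => F (x, y))) => //.
- exact: continuous_line1.
- by apply: F0; rewrite /= normrN gtr0_norm.
- by apply: F0; rewrite /= gtr0_norm.
Qed.

Lemma square_integral_partial2 F Fy n : 0 < n -> continuous Fy -> partial2 F Fy ->
  (forall p, `|p.2| = n -> F p = 0) ->
  \int[area R]_(p in square n) Fy p = 0.
Proof.
move=> n0 cFy dF F0; rewrite /Rintegral square_integral_xy//.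
rewrite integral0_eq// => x _.
apply: (@integral_derivative_vanishing (fun y => F (x, y))) => //.
- exact: continuous_line2.
- by apply: F0; rewrite /= normrN gtr0_norm.
- by apply: F0; rewrite /= gtr0_norm.
Qed.

(** Around a point where F is positive, F stays above a positive constant on a
    rectangle, and rectangles have positive area. *)
Lemma continuous_integral0 F : continuous F -> (forall p, 0 <= F p) ->
  (\int[area R]_p (F p)%:E = 0)%E -> forall p, F p = 0.
Proof.
move=> cF F0 iF [x y]; apply/eqP; rewrite eq_le F0 andbT leNgt; apply/negP => Fp.
pose m := F (x, y) / 2.
have m0 : 0 < m by rewrite divr_gt0.
have /cvgrPdist_lt/(_ _ m0) := cF (x, y).
move=> /nbhs_ballP[e /= e0 He].
pose h := e / 2.
have h0 : 0 < h by rewrite divr_gt0.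
pose B : set plane := `[x - h, x + h] `*` `[y - h, y + h].
have mB : measurable B by apply: measurableX; exact: measurable_itv.
have /measurable_EFinP mF := continuous_measurable_plane cF.
suff : (0 < \int[area R]_p (F p)%:E)%E by rewrite iF ltxx.
apply: (@lt_le_trans _ _ (\int[area R]_(p in B) (m%:E))%E).
  rewrite integral_cst// mule_gt0// area_rectangle; [|exact: measurable_itv..].
  rewrite /= !lebesgue_measure_itv/= !lte_fin !ifT; [|lra..].
  by rewrite -!EFinB -EFinM lte_fin mulr_gt0//; lra.
apply: (@le_trans _ _ (\int[area R]_(p in B) (F p)%:E)%E).
  apply: ge0_le_integral => //.
  - by move=> p _; rewrite lee_fin ltW.
  - exact: measurable_funTS.
  - move=> -[x' y'] /= [] /=; rewrite !in_itv/= lee_fin => /andP[h1 h2] /andP[h3 h4].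
    have /He : ball (x, y) e (x', y').
      by split; rewrite /ball/= ltr_norml; rewrite /h in h1 h2 h3 h4; lra.
    by rewrite /= ltr_norml => /andP[_]; rewrite /m; lra.
apply: ge0_subset_integral => //.
by move=> p _; rewrite lee_fin.
Qed.

Definition area_integrable F : Prop := (area R).-integrable setT (EFin \o F).

Lemma area_integrableD F G : area_integrable F -> area_integrable G ->
  area_integrable (fun z => F z + G z).
Proof.
move=> iF iG; rewrite /area_integrable /comp; under eq_fun do rewrite EFinD.
exact: integrableD.
Qed.

Lemma area_integrableZ c F : area_integrable F -> area_integrable (fun z => c * F z).
Proof.
move=> iF; rewrite /area_integrable /comp; under eq_fun do rewrite EFinM.
exact: integrableZl.
Qed.

Lemma area_RintegralD F G : area_integrable F -> area_integrable G ->
  \int[area R]_z (F z + G z) = \int[area R]_z F z + \int[area R]_z G z.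
Proof. by move=> iF iG; exact: RintegralD. Qed.

Lemma area_RintegralZ c F : area_integrable F ->
  \int[area R]_z (c * F z) = c * \int[area R]_z F z.
Proof. by move=> iF; exact: RintegralZl. Qed.

End PlaneMeasure.

(** * Holomorphic pairs and the weak Laplacian *)

Section Bell.
Variable R : realType.
Implicit Types x : R.

Lemma is_derive_mul (f g : R -> R) x df dg :
  is_derive x (1 : R) f df -> is_derive x (1 : R) g dg ->
  is_derive x (1 : R) (fun t => f t * g t) (df * g x + f x * dg).
Proof.
move=> hf hg; apply: (is_derive_eq (is_deriveM hf hg)).
by rewrite /GRing.scale/= addrC mulrC.
Qed.

Definition bell x := expR (- x ^+ 2).

Lemma is_derive_bell x : is_derive x 1 bell (- (2 * x) * bell x).
Proof.
rewrite mulrC; apply: (@is_derive1_comp _ expR (fun t => - t ^+ 2)).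
apply: (is_derive_eq (is_deriveN (is_derive_mul (is_derive_id x 1) (is_derive_id x 1)))).
by rewrite /=; ring.
Qed.

Lemma continuous_bell : continuous bell.
Proof.
move=> x; apply: differentiable_continuous; apply/derivable1_diffP.
exact: (@ex_derive _ _ _ _ _ _ _ (is_derive_bell x)).
Qed.

End Bell.

(** A constant of its own, so that [cont] below can match on the function before
    the definition of continuity is unfolded. *)
Definition cts (R : realType) (F : R * R -> R) : Prop := continuous F.

Section Continuity.
Variable R : realType.
Implicit Types F G : R * R -> R.

Lemma ctsM F G : cts F -> cts G -> cts (fun p => F p * G p).
Proof. by move=> cF cG p; apply: cvgM; [exact: cF|exact: cG]. Qed.

Lemma ctsD F G : cts F -> cts G -> cts (fun p => F p + G p).
Proof. by move=> cF cG p; apply: cvgD; [exact: cF|exact: cG]. Qed.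

Lemma ctsN F : cts F -> cts (fun p => - F p).
Proof. by move=> cF p; apply: cvgN; exact: cF. Qed.

Lemma cts_cst (c : R) : cts (fun _ => c).
Proof. by move=> p; exact: cvg_cst. Qed.

Lemma ctsX F k : cts F -> cts (fun p => F p ^+ k).
Proof.
move=> cF; elim: k => [|k IHk]; first exact: cts_cst.
by under eq_fun do rewrite exprS; exact: ctsM.
Qed.

Lemma cts_norm F : cts F -> cts (fun p => `|F p|).
Proof. by move=> cF p; apply: cvg_norm; exact: cF. Qed.

Lemma cts_fst : cts (fun p : R * R => p.1).
Proof. by move=> p; exact: cvg_fst. Qed.

Lemma cts_snd : cts (fun p : R * R => p.2).
Proof. by move=> p; exact: cvg_snd. Qed.

Lemma cts_comp (g : R -> R) F : continuous g -> cts F -> cts (fun p => g (F p)).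
Proof. by move=> cg cF p; apply: continuous_comp; [exact: cF|exact: cg]. Qed.

Lemma cts_pair F (f g : R * R -> R) : cts F -> cts f -> cts g ->
  cts (fun z => F (f z, g z)).
Proof. exact: continuous_pair. Qed.

End Continuity.

Ltac cont :=
  lazymatch goal with
  | |- cts (fun z => _ + _) => apply: ctsD; cont
  | |- cts (fun z => _ * _) => apply: ctsM; cont
  | |- cts (fun z => - _) => apply: ctsN; cont
  | |- cts (fun z => _ ^+ _) => apply: ctsX; cont
  | |- cts (fun z => `|_|) => apply: cts_norm; cont
  | |- cts (fun z => bell _) => apply: (cts_comp (@continuous_bell _)); cont
  | |- cts fst => exact: cts_fst
  | |- cts (fun z => z.1) => exact: cts_fst
  | |- cts snd => exact: cts_snd
  | |- cts (fun z => z.2) => exact: cts_snd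
  | |- cts (fun z => ?c) => first [exact: cts_cst | assumption]
  | |- _ => try assumption
  end.

Section WeakLaplacian.
Variable R : realType.
Local Notation plane := (plane R).
Implicit Types (F G u v p q psi psix psiy psixx psiyy A : R * R -> R) (n : R).

Lemma partial1M F F' G G' : partial1 F F' -> partial1 G G' ->
  partial1 (fun z => F z * G z) (fun z => F' z * G z + F z * G' z).
Proof. by move=> dF dG x y; exact: is_derive_mul (dF x y) (dG x y). Qed.

Lemma partial2M F F' G G' : partial2 F F' -> partial2 G G' ->
  partial2 (fun z => F z * G z) (fun z => F' z * G z + F z * G' z).
Proof. by move=> dF dG x y; exact: is_derive_mul (dF x y) (dG x y). Qed.

Lemma partial1D F Fx G Gx : partial1 F Fx -> partial1 G Gx ->
  partial1 (fun z => F z + G z) (fun z => Fx z + Gx z).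
Proof. by move=> dF dG x y; exact: is_deriveD (dF x y) (dG x y). Qed.

Lemma partial2D F Fy G Gy : partial2 F Fy -> partial2 G Gy ->
  partial2 (fun z => F z + G z) (fun z => Fy z + Gy z).
Proof. by move=> dF dG x y; exact: is_deriveD (dF x y) (dG x y). Qed.

Lemma partial1N F Fx : partial1 F Fx -> partial1 (fun z => - F z) (fun z => - Fx z).
Proof. by move=> dF x y; exact: is_deriveN (dF x y). Qed.

Lemma partial2N F Fy : partial2 F Fy -> partial2 (fun z => - F z) (fun z => - Fy z).
Proof. by move=> dF x y; exact: is_deriveN (dF x y). Qed.

(** The pairs (u, v) and (p, q) stand for f = u + i v and f' = p + i q. The
    derivative f' enters through its continuity only: a continuous second derivative
    would have to come from Goursat's theorem. *)
Definition holomorphic_pair u v p q :=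
  [/\ cts u, cts v, cts p & cts q] /\
  [/\ partial1 u p, partial1 v q, partial2 u (fun z => - q z) & partial2 v p].

Definition vanish_on_boundary n F := forall z : R * R, `|z.1| = n \/ `|z.2| = n -> F z = 0.

(** For f = u + i v and g = U + i V, the two integrands add up to the real
    part of 2 d/dzbar (psi g conj(f)). The derivative of g cancels because g is holomorphic,
    which leaves an identity that is linear in g. *)
Lemma polarized_divergence psi psix psiy U V P Q u v p q n : 0 < n ->
  cts psi -> cts psix -> cts psiy ->
  partial1 psi psix -> partial2 psi psiy -> vanish_on_boundary n psi ->
  holomorphic_pair U V P Q -> holomorphic_pair u v p q ->
  \int[area R]_(z in square n)
     (U z * (psix z * u z + psiy z * v z + 2 * (psi z * p z))) +
  \int[area R]_(z in square n)
     (V z * (psix z * v z - psiy z * u z + 2 * (psi z * q z))) = 0.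
Proof.
move=> n0 cpsi cpsix cpsiy dx dy psi0.
move=> [[cU cV cP cQ] [Ux Vx Uy Vy]] [[cu cv cp cq] [ux vx uy vy]].
have int_sq F : cts F -> (area R).-integrable (square n) (EFin \o F).
  exact: continuous_square_integrable.
rewrite -RintegralD; [|exact: measurable_square|by apply: int_sq; cont..].
have Fx := partial1M dx (partial1D (partial1M Ux ux) (partial1M Vx vx)).
have Fy := partial2M dy (partial2D (partial2M Uy vy) (partial2N (partial2M Vy uy))).
have Ix cF := square_integral_partial1 n0 (cF : cts _) Fx.
have Iy cF := square_integral_partial2 n0 (cF : cts _) Fy.
have {}Ix := Ix ltac:(cont) (fun z zn => ltac:(by rewrite psi0 ?mul0r//; left)).
have {}Iy := Iy ltac:(cont) (fun z zn => ltac:(by rewrite psi0 ?mul0r//; right)).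
rewrite -[RHS](addr0 0) -[X in _ = X + _]Ix -[X in _ = _ + X]Iy.
rewrite -RintegralD; [|exact: measurable_square|by apply: int_sq; cont..].
by apply: eq_Rintegral => z _ /=; ring.
Qed.

Definition shift (h : R) F : R * R -> R := fun z => F (z.1 + h, z.2).

Lemma cts_shift h F : cts F -> cts (shift h F).
Proof.
move=> cF; apply: (cts_pair (f := fun z => z.1 + h) (g := fun z => z.2) cF).
  by cont.
by cont.
Qed.

Lemma partial1_shift h F Fx : partial1 F Fx -> partial1 (shift h F) (shift h Fx).
Proof.
move=> dF x y; rewrite -[shift h Fx (x, y)]mulr1.
apply: (@is_derive1_comp _ (fun t => F (t, y)) (fun t => t + h)) => /=.
  exact: dF.
by apply: is_derive_eq; rewrite addr0.
Qed.

Lemma partial2_shift h F Fy : partial2 F Fy -> partial2 (shift h F) (shift h Fy).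
Proof. by move=> dF x y; exact: (dF (x + h) y). Qed.

Lemma holomorphic_pair_shift h u v p q : holomorphic_pair u v p q ->
  holomorphic_pair (shift h u) (shift h v) (shift h p) (shift h q).
Proof.
move=> [[cu cv cp cq] [ux vx uy vy]]; split; first by split; exact: cts_shift.
by split; [exact: partial1_shift|exact: partial1_shift|exact: (partial2_shift h uy)|
  exact: partial2_shift].
Qed.

(** Differentiation under the integral: the difference quotients are dominated because
    p, being continuous, is bounded on a slightly larger square. *)
Lemma is_derive_shift_integral u p A n : cts u -> cts p -> cts A ->
  partial1 u p ->
  is_derive (0 : R) 1 (fun h => \int[area R]_(z in square n) (shift h u z * A z))
    (\int[area R]_(z in square n) (p z * A z)).
Proof.
move=> cu cp cA up.
have [M M0 HM] := bounded_square (`|n| + 1) cp.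
pose f (h : R) (z : plane) := shift h u z * A z.
have df (h : R) z : is_derive h (1 : R) (f ^~ z) (shift h p z * A z).
  have uh : is_derive h (1 : R) (fun t => u (z.1 + t, z.2)) (shift h p z).
    rewrite -[shift h p z]mulr1.
    apply: (@is_derive1_comp _ (fun t => u (t, z.2)) (fun t => z.1 + t)) => /=.
      exact: up.
    exact: (is_derive_eq (is_deriveD (is_derive_cst (z.1 : R) h 1) (is_derive_id h 1)) (add0r _)).
  apply: (is_derive_eq (is_deriveM uh (is_derive_cst (A z) h 1))).
  by rewrite /= scaler0 add0r mulrC.
have d1f h z : partial1of2 f h z = shift h p z * A z.
  by rewrite partial1of2E (@derive_val _ _ _ _ _ _ _ (df h z)).
have I0 : `](-1), 1[%classic (0 : R) by rewrite /= in_itv/=; lra.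
have intf (h : R) : `](-1), 1[%classic h -> (area R).-integrable (square n) (EFin \o f h).
  move=> _; apply: continuous_square_integrable; apply: ctsM => //.
  exact: cts_shift.
have derf (h : R) z : `](-1), 1[%classic h -> square n z -> derivable (f ^~ z) h 1.
  by move=> _ _; exact: (@ex_derive _ _ _ _ _ _ _ (df h z)).
have G0 z : 0 <= M * `|A z| by rewrite mulr_ge0.
have intG : (area R).-integrable (square n) (EFin \o (fun z => M * `|A z|)).
  by apply: continuous_square_integrable; change (cts (fun z => M * `|A z|)); cont.
have Gub (h : R) z : `](-1), 1[%classic h -> square n z ->
    `|partial1of2 f h z| <= M * `|A z|.
  rewrite /= in_itv/= => /andP[h1 h2] /squareE[z1 z2].
  rewrite d1f normrM ler_wpM2r// HM// squareE/=; split.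
    rewrite (le_trans (ler_normD _ _))// lerD//.
      by rewrite (le_trans z1)// ler_norm.
    by rewrite ler_norml; lra.
  by rewrite (le_trans z2)// (le_trans (ler_norm _))// lerDl.
have mD : measurable (square n : set plane) by exact: measurable_square.
apply: DeriveDef.
  exact: (derivable_under_integral mD I0 intf derf G0 intG Gub).
rewrite -derive1E (differentiation_under_integral mD I0 intf derf G0 intG Gub).
by apply: eq_Rintegral => z _; rewrite d1f /shift addr0 -surjective_pairing.
Qed.

(** This is Lap |f|^2 = 4 |f'|^2 integrated against the test function psi. The identity
    [polarized_divergence] holds for all translates g = f (. + h) with h real;
    its derivative at h = 0 has f' in place of g. The remaining first order terms
    contain half the gradient of |f|^2, and are integrated by parts once more. *)
Lemma weak_laplacian psi psix psiy psixx psiyy u v p q n : 0 < n ->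
  [/\ cts psi, cts psix, cts psiy, cts psixx &
      cts psiyy] ->
  [/\ partial1 psi psix, partial2 psi psiy, partial1 psix psixx &
      partial2 psiy psiyy] ->
  [/\ vanish_on_boundary n psi, vanish_on_boundary n psix & vanish_on_boundary n psiy] ->
  holomorphic_pair u v p q ->
  4 * \int[area R]_(z in square n) (psi z * (p z ^+ 2 + q z ^+ 2)) =
  \int[area R]_(z in square n) ((psixx z + psiyy z) * (u z ^+ 2 + v z ^+ 2)).
Proof.
move=> n0 [cpsi cpsix cpsiy cpsixx cpsiyy] [dx dy dxx dyy] [psi0 psix0 psiy0] huv.
have [[cu cv cp cq] [ux vx uy vy]] := huv.
have int_sq F : cts F -> (area R).-integrable (square n) (EFin \o F).
  exact: continuous_square_integrable.
pose A z := psix z * u z + psiy z * v z + 2 * (psi z * p z).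
pose B z := psix z * v z - psiy z * u z + 2 * (psi z * q z).
have cA : cts A by rewrite /A; cont.
have cB : cts B by rewrite /B; cont.
have J0 h : \int[area R]_(z in square n) (shift h u z * A z) +
    \int[area R]_(z in square n) (shift h v z * B z) = 0.
  exact: (polarized_divergence n0 cpsi cpsix cpsiy dx dy psi0 (holomorphic_pair_shift h huv) huv).
have K : \int[area R]_(z in square n) (p z * A z) +
    \int[area R]_(z in square n) (q z * B z) = 0.
  have := is_deriveD (is_derive_shift_integral n cu cp cA ux)
    (is_derive_shift_integral n cv cq cB vx).
  rewrite (_ : _ + _ = cst (0 : R)); last by apply/funext => h; exact: J0.
  by move=> d; rewrite -(@derive_val _ _ _ _ _ _ _ d) derive_cst.
rewrite -RintegralD in K; [|exact: measurable_square|by apply: int_sq; cont..].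
have Fx := partial1M dxx (partial1D (partial1M ux ux) (partial1M vx vx)).
have Fy := partial2M dyy (partial2D (partial2M uy uy) (partial2M vy vy)).
have Ix cF := square_integral_partial1 n0 (cF : cts _) Fx.
have Iy cF := square_integral_partial2 n0 (cF : cts _) Fy.
have {}Ix := Ix ltac:(by cont) (fun z zn => ltac:(by rewrite psix0 ?mul0r//; left)).
have {}Iy := Iy ltac:(by cont) (fun z zn => ltac:(by rewrite psiy0 ?mul0r//; right)).
apply/eqP; rewrite -subr_eq0 -RintegralZl; [|exact: measurable_square|by apply: int_sq; cont].
rewrite -RintegralB; [|exact: measurable_square|by apply: int_sq; cont..].
have IxIy : \int[area R]_(z in square n)
   (psixx z * (u z * u z + v z * v z) +
     psix z * (p z * u z + u z * p z + (q z * v z + v z * q z)) +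
   (psiyy z * (u z * u z + v z * v z) +
     psiy z * (- q z * u z + u z * - q z + (p z * v z + v z * p z)))) = 0.
  rewrite RintegralD ?Ix ?Iy ?addr0//; [exact: measurable_square|by apply: int_sq; cont..].
rewrite -[X in _ == X](subr0 0) -[X in _ == X - _](mulr0 2) -{1}K -[X in _ == _ - X]IxIy.
rewrite -RintegralZl; [|exact: measurable_square|by apply: int_sq; cont].
rewrite -RintegralB; [|exact: measurable_square|by apply: int_sq; cont..].
by apply/eqP; apply: eq_Rintegral => z _; rewrite /A /B; ring.
Qed.

End WeakLaplacian.

(** * Cutoffs on growing squares *)

Section Cutoff.
Variable R : realType.
Local Notation plane := (plane R).
Implicit Types (r x : R) (z : R * R).

(** The zero at |x| = 1 / r is double, so that the products with a Gaussian vanish on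
    the boundary of the square together with their first derivatives. The
    derivatives [cut1] and [cut2] are arranged in powers of r and of x r, with
    |x r| <= 1 on the square, which makes the uniform bounds visible. *)
Definition cut r x := (1 - (x * r) ^+ 2) ^+ 2.
Definition cut1 r x := - 4 * r * ((x * r) * (1 - (x * r) ^+ 2)).
Definition cut2 r x := r ^+ 2 * (12 * (x * r) ^+ 2 - 4).

Lemma is_derive_scaled_sq r x :
  is_derive x 1 (fun t => 1 - (t * r) ^+ 2) (- (2 * x * r ^+ 2)).
Proof.
have d1 := is_derive_mul (is_derive_id x 1) (is_derive_cst r x 1).
have d := is_deriveB (is_derive_cst (1 : R) x 1) (is_derive_mul d1 d1).
by apply: (is_derive_eq d); rewrite /=; ring.
Qed.

Lemma is_derive_cut r x : is_derive x 1 (cut r) (cut1 r x).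
Proof.
have d := is_derive_scaled_sq r x.
by apply: (is_derive_eq (is_derive_mul d d)); rewrite /cut1; ring.
Qed.

Lemma is_derive_cut1 r x : is_derive x 1 (cut1 r) (cut2 r x).
Proof.
have d1 := is_derive_mul (is_derive_id x 1) (is_derive_cst r x 1).
have d := is_derive_mul (is_derive_cst (- 4 * r) x 1)
  (is_derive_mul d1 (is_derive_scaled_sq r x)).
by apply: (is_derive_eq d); rewrite /cut2 /=; ring.
Qed.

Definition bump r x := cut r x * bell x.
Definition bump1 r x := (cut1 r x - 2 * x * cut r x) * bell x.
Definition bump2 r x := (cut2 r x - 4 * (x * cut1 r x) + (4 * x ^+ 2 - 2) * cut r x) * bell x.

Lemma is_derive_bump r x : is_derive x 1 (bump r) (bump1 r x).
Proof.
apply: (is_derive_eq (is_derive_mul (is_derive_cut r x) (is_derive_bell x))).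
by rewrite /bump1; ring.
Qed.

Lemma is_derive_bump1 r x : is_derive x 1 (bump1 r) (bump2 r x).
Proof.
have d2 := is_derive_mul (is_derive_cst (2 : R) x 1) (is_derive_id x 1).
have d := is_deriveB (is_derive_cut1 r x) (is_derive_mul d2 (is_derive_cut r x)).
apply: (is_derive_eq (is_derive_mul d (is_derive_bell x))).
by rewrite /bump2 !fctE /=; ring.
Qed.

Lemma cut_boundary n x : 0 < n -> `|x| = n -> 1 - (x * n^-1) ^+ 2 = 0.
Proof.
move=> n0 xn; rewrite -(real_normK (num_real _)) normrM xn gtr0_norm ?invr_gt0//.
by rewrite divff ?gt_eqF// expr1n subrr.
Qed.

Lemma bump_boundary n x : 0 < n -> `|x| = n -> bump n^-1 x = 0.
Proof. by move=> n0 xn; rewrite /bump /cut cut_boundary// expr0n mul0r. Qed.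

Lemma bump1_boundary n x : 0 < n -> `|x| = n -> bump1 n^-1 x = 0.
Proof.
by move=> n0 xn; rewrite /bump1 /cut /cut1 cut_boundary// expr0n !mulr0 subr0 mul0r.
Qed.

Definition weight r z := cut r z.1 * cut r z.2.
Definition weight1 r z := cut1 r z.1 * cut r z.2.
Definition weight2 r z := cut r z.1 * cut1 r z.2.
(** With the Gaussian e^(-|z|^2) factored out, the Laplacian of the product of two
    bumps is this term plus 4 (|z|^2 - 1) times [weight]. *)
Definition weight_laplacian r z :=
  (cut2 r z.1 - 4 * (z.1 * cut1 r z.1)) * cut r z.2 +
  cut r z.1 * (cut2 r z.2 - 4 * (z.2 * cut1 r z.2)).

Lemma sqr_itv01 r x : `|x * r| <= 1 -> 0 <= (x * r) ^+ 2 <= 1.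
Proof. by rewrite ler_norml => /andP[h1 h2]; nra. Qed.

Lemma cut_itv r x : `|x * r| <= 1 -> 0 <= cut r x <= 1.
Proof. by move=> /sqr_itv01; rewrite /cut => /andP[h1 h2]; nra. Qed.

Lemma cut1_bound r x : 0 <= r <= 1 -> `|x * r| <= 1 -> `|cut1 r x| <= 4.
Proof.
move=> /andP[r0 r1] h; have /andP[h1 h2] := sqr_itv01 h.
rewrite /cut1; move: (x * r) h h1 h2 => t h h1 h2.
rewrite !normrM normrN (ger0_norm r0) (ger0_norm (_ : 0 <= 4 :> R))//.
rewrite [X in _ <= X](_ : 4 = 4 * 1 * (1 * 1)); last by ring.
rewrite ler_pM ?mulr_ge0//; first by rewrite ler_wpM2l.
rewrite ler_pM// ger0_norm; lra.
Qed.

Lemma cut2_bound r x : 0 <= r <= 1 -> `|x * r| <= 1 ->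
  `|cut2 r x - 4 * (x * cut1 r x)| <= 24.
Proof.
move=> /andP[r0 r1] h; have /andP[h1 h2] := sqr_itv01 h.
rewrite /cut2 (_ : x * cut1 r x = - 4 * ((x * r) ^+ 2 * (1 - (x * r) ^+ 2))); last first.
  by rewrite /cut1; ring.
set t := (x * r) ^+ 2 in h1 h2 *.
have : 0 <= r ^+ 2 <= 1 by rewrite sqr_ge0 expr_le1.
move: (r ^+ 2) => q /andP[q0 q1].
have : 0 <= t * (1 - t) <= 1 by nra.
have : -4 <= q * (12 * t - 4) <= 8 by nra.
by rewrite ler_norml; lra.
Qed.

Lemma weight_itv r z : `|z.1 * r| <= 1 -> `|z.2 * r| <= 1 -> 0 <= weight r z <= 1.
Proof.
move=> /cut_itv/andP[a0 a1] /cut_itv/andP[b0 b1].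
by rewrite /weight mulr_ge0// -[leRHS](mulr1 1) ler_pM.
Qed.

Lemma normr_cut_le1 r x : `|x * r| <= 1 -> `|cut r x| <= 1.
Proof. by move=> /cut_itv/andP[a0 a1]; rewrite ger0_norm. Qed.

Lemma weight1_bound r z : 0 <= r <= 1 -> `|z.1 * r| <= 1 -> `|z.2 * r| <= 1 ->
  `|weight1 r z| <= 4.
Proof.
move=> r01 h1 h2; rewrite normrM -[leRHS](mulr1 4) ler_pM//.
  exact: cut1_bound.
exact: normr_cut_le1.
Qed.

Lemma weight2_bound r z : 0 <= r <= 1 -> `|z.1 * r| <= 1 -> `|z.2 * r| <= 1 ->
  `|weight2 r z| <= 4.
Proof.
move=> r01 h1 h2; rewrite normrM -[leRHS](mul1r 4) ler_pM//.
  exact: normr_cut_le1.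
exact: cut1_bound.
Qed.

Lemma weight_laplacian_bound r z : 0 <= r <= 1 -> `|z.1 * r| <= 1 -> `|z.2 * r| <= 1 ->
  `|weight_laplacian r z| <= 48.
Proof.
move=> r01 h1 h2; apply: le_trans (ler_normD _ _) _.
rewrite (_ : 48 = 24 * 1 + 1 * 24); last by ring.
by rewrite lerD// normrM ler_pM// ?normr_cut_le1// cut2_bound.
Qed.

Lemma square_scaled n z : 0 < n -> square n z ->
  `|z.1 * n^-1| <= 1 /\ `|z.2 * n^-1| <= 1.
Proof.
move=> n0 /squareE[z1 z2].
by rewrite !normrM [`|n^-1|]gtr0_norm ?invr_gt0// !ler_pdivrMr// !mul1r.
Qed.

Let m (k : nat) : R := k.+1%:R.
Let r_ (k : nat) : R := (m k)^-1.
Let m0 k : 0 < m k. Proof. by rewrite ltr0n. Qed.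
Let r01 k : 0 <= r_ k <= 1.
Proof. by rewrite invr_ge0 ler0n/= invf_le1// ler1n. Qed.

(** The weights are polynomials in the inverse [r] of the half-side of the square,
    so their limit along the growing squares is their value at [r = 0]. *)
Lemma truncated_cvg (H : R * R -> R) (c : R -> R * R -> R) (l : R) z :
  cts (fun q => c q.1 z) -> c 0 z = l ->
  ((fun t => (c (r_ k) t * H t)%:E) \_ (square (m k))) z @[k --> \oo] --> (l * H z)%:E.
Proof.
move=> cr <-.
have cz : continuous (fun t : R => c t z) by exact: (continuous_line1 (y := 0) cr).
have : (c (r_ k) z * H z)%:E @[k --> \oo] --> (c 0 z * H z)%:E.
  apply: cvg_EFin; first exact: nearW.
  apply: cvgMl; apply: (cvg_comp r_ (fun q => c q z) _ (cz 0)); exact: cvg_harmonic.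
apply: cvg_trans; apply: near_eq_cvg.
near=> k.
rewrite patchE ifT// inE squareE.
by split; apply: (@le_trans _ _ k%:R); rewrite ?ler_nat//;
  near: k; exact: nbhs_infty_ger.
Unshelve. all: by end_near. Qed.

(** Dominated convergence: the bounds on [z.1 * r] and [z.2 * r] say that z lies in the
    square of half-side 1 / r, outside which the weight may grow. *)
Lemma cutoff_cvg (H : R * R -> R) (c : R -> R * R -> R) (l M : R) :
  area_integrable H ->
  (forall r, cts (c r)) ->
  (forall z, cts (fun q => c q.1 z)) ->
  (forall z, c 0 z = l) ->
  (forall r z, 0 <= r <= 1 -> `|z.1 * r| <= 1 -> `|z.2 * r| <= 1 -> `|c r z| <= M) ->
  \int[area R]_(z in square (m k)) (c (r_ k) z * H z) @[k --> \oo] -->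
  l * \int[area R]_z H z.
Proof.
move=> iH cc cr c0 cM.
have mH : measurable_fun [set: plane] H.
  by apply/measurable_EFinP; exact: measurable_int iH.
pose F k := (fun z => (c (r_ k) z * H z)%:E) \_ (square (m k)).
have mF k : measurable_fun [set: plane] (F k).
  apply/(measurable_restrictT _ (measurable_square _)).
  apply: measurable_funTS; apply/measurable_EFinP; apply: measurable_funM => //.
  exact: (continuous_measurable_plane (cc _)).
have mlH : measurable_fun [set: plane] (fun z => (l * H z)%:E).
  by apply/measurable_EFinP; exact: measurable_funM.
have M0 : 0 <= M.
  have := cM 0 (0, 0); rewrite /= !mul0r normr0 lexx ler01 => /(_ isT isT isT).
  exact: le_trans.
have iMH : (area R).-integrable setT (fun z => (M * `|H z|)%:E).
  under eq_fun do rewrite EFinM.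
  by apply: integrableZl => //; exact: integrable_norm.
have cvF z : F k z @[k --> \oo] --> (l * H z)%:E by exact: truncated_cvg (cr z) (c0 z).
have bF k z : (`|F k z| <= (M * `|H z|)%:E)%E.
  rewrite /F patchE; case: ifPn => [|_]; last by rewrite abse0 lee_fin mulr_ge0.
  rewrite inE => /(square_scaled (m0 k))[z1 z2].
  by rewrite lee_fin normrM ler_wpM2r// cM.
have aeF : {ae area R, forall z : plane, [set: plane] z ->
    F k z @[k --> \oo] --> (l * H z)%:E} by apply: aeW => z _; exact: cvF.
have aeb : {ae area R, forall z : plane, forall k, [set: plane] z ->
    (`|F k z| <= (M * `|H z|)%:E)%E} by apply: aeW => z k _; exact: bF.
have [_ _ cvI] := @dominated_convergence _ _ _ (area R) setT measurableT F
  (fun z => (l * H z)%:E) (fun z => (M * `|H z|)%:E) mF mlH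
  aeF iMH aeb.
have -> : l * \int[area R]_z H z = \int[area R]_z (l * H z) by rewrite RintegralZl.
have -> : (fun k => \int[area R]_(z in square (m k)) (c (r_ k) z * H z)) =
    (fun k => fine (\int[area R]_z F k z)%E).
  by apply/funext => k; rewrite /Rintegral integral_mkcond.
apply: fine_cvg; rewrite fineK//.
apply: integrable_fin_num => //; under eq_fun do rewrite EFinM.
exact: integrableZl.
Qed.

(** Fatou's lemma: bounds on truncated integrals are all that is available for z f
    before it is known to be square integrable. *)
Lemma cutoff_integrable (H : R * R -> R) (B : R) : cts H -> (forall z, 0 <= H z) ->
  (forall k, \int[area R]_(z in square (m k)) (weight (r_ k) z * H z) <= B) ->
  area_integrable H.
Proof.
move=> cH H0 HB.
pose F k := (fun z => (weight (r_ k) z * H z)%:E) \_ (square (m k)).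
have cW r : cts (weight r).
  by rewrite /weight /cut; cont.
have mF k : measurable_fun [set: plane] (F k).
  apply/(measurable_restrictT _ (measurable_square _)).
  apply: measurable_funTS; apply/measurable_EFinP.
  by apply: (@continuous_measurable_plane _ (fun z => weight (r_ k) z * H z)); exact: ctsM.
have F0 k z : (0 <= F k z)%E.
  rewrite /F patchE; case: ifPn => // /[!inE] /(square_scaled (m0 k))[z1 z2].
  by rewrite lee_fin mulr_ge0//; have /andP[] := weight_itv z1 z2.
have cvF z : F k z @[k --> \oo] --> (H z)%:E.
  rewrite -[H z]mul1r; apply: truncated_cvg.
    by rewrite /weight /cut; cont.
  by rewrite /weight /cut !mulr0 expr0n subr0 !expr1n mulr1.
have mH : measurable_fun [set: plane] (EFin \o H).
  by apply/measurable_EFinP; exact: continuous_measurable_plane cH.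
apply/integrableP; split => //.
have -> : (\int[area R]_z `|(EFin \o H) z| = \int[area R]_z limn_einf (F ^~ z))%E.
  apply: eq_integral => z _; rewrite (cvg_limn_einf_sup (cvF z)).1 gee0_abs//=.
  by rewrite lee_fin.
apply: (@le_lt_trans _ _ B%:E); last exact: ltry.
apply: le_trans (fatou _ _ mF _) _ => //.
have FB k : (\int[area R]_z F k z <= B%:E)%E.
  rewrite /F -integral_mkcond; have := HB k.
  rewrite -lee_fin /Rintegral fineK//.
  apply: integrable_fin_num; first exact: measurable_square.
  apply: (@continuous_square_integrable _ (fun z => weight (r_ k) z * H z)).
  exact: ctsM.
rewrite limn_einf_lim; apply: lime_le; first exact: is_cvg_einfs.
apply: nearW => k; apply: le_trans (FB k); apply: ereal_inf_lbound.
by exists k => /=.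
Qed.

End Cutoff.

(** * Gaussian moments of a holomorphic pair *)

Lemma limit_relation (R : realType) (c1 c2 c3 c4 : R) (a b c d : nat -> R) (A B C D : R) :
  a @ \oo --> A -> b @ \oo --> B -> c @ \oo --> C -> d @ \oo --> D ->
  (forall k, c1 * a k + c2 * b k + c3 * c k + c4 * d k = 0) ->
  c1 * A + c2 * B + c3 * C + c4 * D = 0.
Proof.
move=> cA cB cC cD H.
have : (fun k => c1 * a k + c2 * b k + c3 * c k + c4 * d k) @ \oo -->
    c1 * A + c2 * B + c3 * C + c4 * D.
  have Z (x : R) (f : nat -> R) (l : R) : f @ \oo --> l -> (fun k => x * f k) @ \oo --> x * l.
    by move=> fl; exact: (cvgM (cvg_cst x) fl).
  exact: (cvgD (cvgD (cvgD (Z _ _ _ cA) (Z _ _ _ cB)) (Z _ _ _ cC)) (Z _ _ _ cD)).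
rewrite (_ : (fun k => _) = cst 0); last exact/funext.
by move=> h; rewrite -(cvg_lim _ h)//; apply: cvg_lim => //; exact: cvg_cst.
Qed.

Section GaussianIdentities.
Variable R : realType.
Local Notation plane := (plane R).
Implicit Types (z : R * R) (F G H : R * R -> R).

Definition gaussian z := (pi : R)^-1 * (bell z.1 * bell z.2).

Lemma gaussian_gt0 z : 0 < gaussian z.
Proof. by rewrite mulr_gt0 ?invr_gt0 ?pi_gt0// mulr_gt0// expR_gt0. Qed.

Lemma gaussian_ge0 z : 0 <= gaussian z.
Proof. exact/ltW/gaussian_gt0. Qed.

Lemma cts_gaussian : cts gaussian.
Proof. by rewrite /gaussian; cont. Qed.

Definition normsq (u v : R * R -> R) z := u z ^+ 2 + v z ^+ 2.

(** The constant is the normalisation of the Gaussian density. *)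
Definition tensor (a b : R -> R) z := (pi : R)^-1 * (a z.1 * b z.2).

Lemma partial1_tensor (a a' b : R -> R) : (forall x, is_derive x (1 : R) a (a' x)) ->
  partial1 (tensor a b) (tensor a' b).
Proof.
move=> da x y.
have := is_derive_mul (is_derive_cst (pi^-1 : R) x 1)
  (is_derive_mul (da x) (is_derive_cst (b y) x 1)).
by move=> d; apply: (is_derive_eq d); rewrite /tensor /=; ring.
Qed.

Lemma partial2_tensor (a b b' : R -> R) : (forall x, is_derive x (1 : R) b (b' x)) ->
  partial2 (tensor a b) (tensor a b').
Proof.
move=> db x y.
have := is_derive_mul (is_derive_cst (pi^-1 : R) y 1)
  (is_derive_mul (is_derive_cst (a x) y 1) (db y)).
by move=> d; apply: (is_derive_eq d); rewrite /tensor /=; ring.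
Qed.

Lemma vanish_tensor n (a b : R -> R) :
  (forall x, `|x| = n -> a x = 0) -> (forall x, `|x| = n -> b x = 0) ->
  vanish_on_boundary n (tensor a b).
Proof. by move=> a0 b0 z [/a0|/b0] e; rewrite /tensor e ?mul0r ?mulr0 ?mulr0. Qed.

Lemma cts_bump_fst (r : R) :
  [/\ cts (fun z : R * R => bump r z.1), cts (fun z : R * R => bump1 r z.1) &
  cts (fun z : R * R => bump2 r z.1)].
Proof. by rewrite /bump /bump1 /bump2 /cut /cut1 /cut2; split; cont. Qed.

Lemma cts_bump_snd (r : R) :
  [/\ cts (fun z : R * R => bump r z.2), cts (fun z : R * R => bump1 r z.2) &
  cts (fun z : R * R => bump2 r z.2)].
Proof. by rewrite /bump /bump1 /bump2 /cut /cut1 /cut2; split; cont. Qed.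

Lemma cts_weights (r : R) :
  [/\ cts (weight r), cts (weight1 r), cts (weight2 r) & cts (weight_laplacian r)].
Proof. by rewrite /weight /weight1 /weight2 /weight_laplacian /cut /cut1 /cut2; split; cont. Qed.

Lemma cts_weights_param z :
  [/\ cts (fun q : R * R => weight q.1 z), cts (fun q : R * R => weight1 q.1 z),
      cts (fun q : R * R => weight2 q.1 z) & cts (fun q : R * R => weight_laplacian q.1 z)].
Proof. by rewrite /weight /weight1 /weight2 /weight_laplacian /cut /cut1 /cut2; split; cont. Qed.

Lemma weights0 z : [/\ weight 0 z = 1, weight1 0 z = 0, weight2 0 z = 0 &
  weight_laplacian 0 z = 0].
Proof. by rewrite /weight /weight1 /weight2 /weight_laplacian /cut /cut1 /cut2; split; ring. Qed.

Let m (k : nat) : R := k.+1%:R.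
Let r_ (k : nat) : R := (m k)^-1.
Let m0 k : 0 < m k. Proof. by rewrite ltr0n. Qed.
Let r01 k : 0 <= r_ k <= 1.
Proof. by rewrite invr_ge0 ler0n/= invf_le1// ler1n. Qed.

Lemma weight_cvg H : area_integrable H ->
  \int[area R]_(z in square (m k)) (weight (r_ k) z * H z) @[k --> \oo] -->
  \int[area R]_z H z.
Proof.
move=> iH; rewrite -[X in _ --> X]mul1r.
apply: (cutoff_cvg (M := 1) iH) => [r|z|z|r z hr z1 z2].
- by have [] := cts_weights r.
- by have [] := cts_weights_param z.
- by have [] := weights0 z.
- by have /andP[w0 w1] := weight_itv z1 z2; rewrite ger0_norm.
Qed.

Lemma weight1_cvg H : area_integrable H ->
  \int[area R]_(z in square (m k)) (weight1 (r_ k) z * H z) @[k --> \oo] --> (0 : R).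
Proof.
move=> iH; rewrite -[X in _ --> X](mul0r (\int[area R]_z H z)).
apply: (cutoff_cvg (M := 4) iH) => [r|z|z|r z hr z1 z2].
- by have [] := cts_weights r.
- by have [] := cts_weights_param z.
- by have [] := weights0 z.
- exact: weight1_bound.
Qed.

Lemma weight2_cvg H : area_integrable H ->
  \int[area R]_(z in square (m k)) (weight2 (r_ k) z * H z) @[k --> \oo] --> (0 : R).
Proof.
move=> iH; rewrite -[X in _ --> X](mul0r (\int[area R]_z H z)).
apply: (cutoff_cvg (M := 4) iH) => [r|z|z|r z hr z1 z2].
- by have [] := cts_weights r.
- by have [] := cts_weights_param z.
- by have [] := weights0 z.
- exact: weight2_bound.
Qed.

Lemma weight_laplacian_cvg H : area_integrable H ->
  \int[area R]_(z in square (m k)) (weight_laplacian (r_ k) z * H z) @[k --> \oo] --> (0 : R).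
Proof.
move=> iH; rewrite -[X in _ --> X](mul0r (\int[area R]_z H z)).
apply: (cutoff_cvg (M := 48) iH) => [r|z|z|r z hr z1 z2].
- by have [] := cts_weights r.
- by have [] := cts_weights_param z.
- by have [] := weights0 z.
- exact: weight_laplacian_bound.
Qed.

Lemma integrable_dominated (F G : R * R -> R) : cts F ->
  area_integrable G -> (forall z, `|F z| <= G z) ->
  area_integrable F.
Proof.
move=> cF iG FG; apply: (le_integrable _ _ _ iG) => //.
  by apply/measurable_EFinP; exact: continuous_measurable_plane cF.
by move=> z _; rewrite lee_fin (le_trans (FG z))// ler_norm.
Qed.

Lemma product_bound (a b c d g : R) : 0 <= g ->
  `|(a * c + b * d) * g| <= (a ^+ 2 + b ^+ 2) * g + (c ^+ 2 + d ^+ 2) * g.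
Proof.
move=> g0; rewrite -mulrDl normrM (ger0_norm g0) ler_wpM2r// ler_norml.
have h1 := sqr_ge0 (a - c); have h2 := sqr_ge0 (b - d).
have h3 := sqr_ge0 (a + c); have h4 := sqr_ge0 (b + d).
have [p1 p2 p3 p4] : [/\ 0 <= a ^+ 2, 0 <= b ^+ 2, 0 <= c ^+ 2 & 0 <= d ^+ 2].
  by split; exact: sqr_ge0.
by rewrite !sqrrB !sqrrD !mulr2n in h1 h2 h3 h4; lra.
Qed.

Section Identities.
Variables u v p q : R * R -> R.
Hypothesis huv : holomorphic_pair u v p q.
Hypothesis intS : area_integrable (fun z => normsq u v z * gaussian z).
Hypothesis intT : area_integrable (fun z => normsq p q z * gaussian z).

Let S := \int[area R]_z (normsq u v z * gaussian z).
Let T := \int[area R]_z (normsq p q z * gaussian z).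
Let cg := cts_gaussian.

Let cSu : cts (normsq u v).
Proof. by have [[cu cv _ _] _] := huv; rewrite /normsq; cont. Qed.

Let cTp : cts (normsq p q).
Proof. by have [[_ _ cp cq] _] := huv; rewrite /normsq; cont. Qed.

Let int_sq n F : cts F -> (area R).-integrable (square n) (EFin \o F).
Proof. exact: continuous_square_integrable. Qed.

Let cutoff_identity k :
  4 * \int[area R]_(z in square (m k)) (weight (r_ k) z * (normsq p q z * gaussian z)) =
  \int[area R]_(z in square (m k)) (weight_laplacian (r_ k) z * (normsq u v z * gaussian z)) +
  4 * \int[area R]_(z in square (m k))
    (weight (r_ k) z * ((z.1 ^+ 2 + z.2 ^+ 2) * (normsq u v z * gaussian z))) -
  4 * \int[area R]_(z in square (m k)) (weight (r_ k) z * (normsq u v z * gaussian z)).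
Proof.
have [[cu cv cp cq] _] := huv.
have [cW _ _ cL] := cts_weights (r_ k).
have [b0 b1 b2] := cts_bump_fst (r_ k).
have [b0' b1' b2'] := cts_bump_snd (r_ k).
have cb (a b : R -> R) : cts (fun z : R * R => a z.1) ->
    cts (fun z : R * R => b z.2) -> cts (tensor a b).
  by move=> ca cb; rewrite /tensor; cont.
have db := is_derive_bump (r_ k); have db1 := is_derive_bump1 (r_ k).
have B0 x : `|x| = m k -> bump (r_ k) x = 0 by exact: bump_boundary.
have B1 x : `|x| = m k -> bump1 (r_ k) x = 0 by exact: bump1_boundary.
have A1 : [/\ cts (tensor (bump (r_ k)) (bump (r_ k))),
    cts (tensor (bump1 (r_ k)) (bump (r_ k))), cts (tensor (bump (r_ k)) (bump1 (r_ k))),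
    cts (tensor (bump2 (r_ k)) (bump (r_ k))) & cts (tensor (bump (r_ k)) (bump2 (r_ k)))].
  by split; exact: cb.
have A2 : [/\ partial1 (tensor (bump (r_ k)) (bump (r_ k))) (tensor (bump1 (r_ k)) (bump (r_ k))),
    partial2 (tensor (bump (r_ k)) (bump (r_ k))) (tensor (bump (r_ k)) (bump1 (r_ k))),
    partial1 (tensor (bump1 (r_ k)) (bump (r_ k))) (tensor (bump2 (r_ k)) (bump (r_ k))) &
    partial2 (tensor (bump (r_ k)) (bump1 (r_ k))) (tensor (bump (r_ k)) (bump2 (r_ k)))].
  by split; [exact: partial1_tensor|exact: partial2_tensor|exact: partial1_tensor|
    exact: partial2_tensor].
have A3 : [/\ vanish_on_boundary (m k) (tensor (bump (r_ k)) (bump (r_ k))),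
    vanish_on_boundary (m k) (tensor (bump1 (r_ k)) (bump (r_ k))) &
    vanish_on_boundary (m k) (tensor (bump (r_ k)) (bump1 (r_ k)))].
  by split; exact: vanish_tensor.
have WL := weak_laplacian (m0 k) A1 A2 A3 huv.
have ms : measurable (square (m k) : set plane) by exact: measurable_square.
rewrite -!RintegralZl//; [|by apply: int_sq; cont..].
rewrite -RintegralD//; [|by apply: int_sq; cont..].
rewrite -RintegralB//; [|by apply: int_sq; cont..].
transitivity (4 * \int[area R]_(z in square (m k))
    (tensor (bump (r_ k)) (bump (r_ k)) z * (p z ^+ 2 + q z ^+ 2))).
  rewrite -RintegralZl//.
    by apply: eq_Rintegral => z _; rewrite /weight /normsq /gaussian /tensor /bump; ring.
  by have [t0 _ _ _ _] := A1; apply: int_sq; cont.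
rewrite WL; apply: eq_Rintegral => z _.
by rewrite /weight_laplacian /weight /normsq /gaussian /tensor /bump /bump2; ring.
Qed.

Let S0 z : 0 <= normsq u v z * gaussian z.
Proof. by rewrite mulr_ge0 ?gaussian_ge0// /normsq addr_ge0 ?sqr_ge0. Qed.

Let T0 z : 0 <= normsq p q z * gaussian z.
Proof. by rewrite mulr_ge0 ?gaussian_ge0// /normsq addr_ge0 ?sqr_ge0. Qed.

(** If f and f' are square integrable for the Gaussian measure, so is z f: in the
    cut-off identity all the other terms are bounded by |f|^2 and |f'|^2, uniformly in
    the square. *)
Lemma integrable_moment :
  area_integrable (fun z => (z.1 ^+ 2 + z.2 ^+ 2) * (normsq u v z * gaussian z)).
Proof.
(* Here 52 = 4 + 48, from the bounds on [weight] and [weight_laplacian]. *)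
pose K z := 4 * (normsq p q z * gaussian z) + 52 * (normsq u v z * gaussian z).
have K0 z : 0 <= K z by rewrite addr_ge0// mulr_ge0.
have cK : cts K by rewrite /K; cont.
have iK : area_integrable K.
  by apply: area_integrableD; exact: area_integrableZ.
apply: (@cutoff_integrable _ _ (4^-1 * \int[area R]_z K z)).
- by cont.
- by move=> z; rewrite mulr_ge0// addr_ge0 ?sqr_ge0.
move=> k; have [cW _ _ cL] := cts_weights (r_ k).
have ms : measurable (square (m k) : set plane) by exact: measurable_square.
rewrite ler_pdivlMl//.
have <- : 4 * \int[area R]_(z in square (m k)) (weight (r_ k) z * (normsq p q z * gaussian z)) +
  4 * \int[area R]_(z in square (m k)) (weight (r_ k) z * (normsq u v z * gaussian z)) -
  \int[area R]_(z in square (m k)) (weight_laplacian (r_ k) z * (normsq u v z * gaussian z)) =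
  4 * \int[area R]_(z in square (m k))
    (weight (r_ k) z * ((z.1 ^+ 2 + z.2 ^+ 2) * (normsq u v z * gaussian z))).
  by rewrite cutoff_identity; ring.
rewrite -!RintegralZl//; [|by apply: int_sq; cont..].
rewrite -RintegralD//; [|by apply: int_sq; cont..].
rewrite -RintegralB//; [|by apply: int_sq; cont..].
apply: (@le_trans _ _ (\int[area R]_(z in square (m k)) K z)).
  apply: le_Rintegral => //; [by apply: int_sq; cont|exact: int_sq|].
  move=> z /(square_scaled (m0 k))[z1 z2].
  have /andP[w0 w1] := weight_itv z1 z2.
  have := weight_laplacian_bound (r01 k) z1 z2; rewrite ler_norml => /andP[l1 l2].
  rewrite -/(r_ k) in w0 w1 l1 l2.
  have h1 := S0 z; have h2 := T0 z; rewrite /K.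
  set s := normsq u v z * gaussian z in h1 *; set t := normsq p q z * gaussian z in h2 *.
  move: (weight (r_ k) z) (weight_laplacian (r_ k) z) w0 w1 l1 l2 => w l w0 w1 l1 l2.
  have : w * t <= t by rewrite ler_piMl.
  have : w * s <= s by rewrite ler_piMl.
  have : (- 48) * s <= l * s by rewrite ler_wpM2r.
  by lra.
apply: fine_le.
- by apply: integrable_fin_num => //; exact: int_sq.
- exact: integrable_fin_num.
- apply: ge0_subset_integral => //.
    by apply/measurable_EFinP; exact: continuous_measurable_plane cK.
  by move=> z _; rewrite lee_fin.
Qed.

(** The commutation relation between differentiation and multiplication by z, seen
    through norms: |z f|^2 = |f'|^2 + |f|^2. *)
Lemma moment_identity :
  \int[area R]_z ((z.1 ^+ 2 + z.2 ^+ 2) * (normsq u v z * gaussian z)) = T + S.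
Proof.
have iZ := integrable_moment.
have cZ := weight_cvg iZ; have cS := weight_cvg intS; have cT := weight_cvg intT.
have cL := weight_laplacian_cvg intS.
have := limit_relation (c1 := 4) (c2 := -1) (c3 := -4) (c4 := 4) cT cL cZ cS.
move=> /(_ (fun k => ltac:(by rewrite cutoff_identity; ring))).
rewrite -/S -/T; lra.
Qed.

Let coordinate_bound (t a b : R) : 0 <= t -> `|a| * t <= t + (a ^+ 2 + b ^+ 2) * t.
Proof.
move=> t0; rewrite -[X in _ <= X + _]mul1r -mulrDl ler_wpM2r//.
have : 0 <= b ^+ 2 by exact: sqr_ge0.
have : `|a| ^+ 2 = a ^+ 2 by rewrite real_normK ?num_real.
move: `|a| => x <- b0; have := sqr_ge0 (x - 1); have := sqr_ge0 x.
by rewrite sqrrB expr1n mulr1 mulr2n; lra.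
Qed.

Lemma integrable_coord1 :
  area_integrable (fun z => z.1 * (normsq u v z * gaussian z)).
Proof.
apply: (integrable_dominated _ (area_integrableD intS integrable_moment)); first by cont.
by move=> z; rewrite normrM (ger0_norm (S0 z)); exact: coordinate_bound.
Qed.

Lemma integrable_coord2 :
  area_integrable (fun z => z.2 * (normsq u v z * gaussian z)).
Proof.
apply: (integrable_dominated _ (area_integrableD intS integrable_moment)); first by cont.
by move=> z; rewrite normrM (ger0_norm (S0 z)) [z.1 ^+ 2 + _]addrC; exact: coordinate_bound.
Qed.

Lemma integrable_cross1 :
  area_integrable (fun z => (u z * p z + v z * q z) * gaussian z).
Proof.
have [[cu cv cp cq] _] := huv.
apply: (integrable_dominated _ (area_integrableD intS intT)); first by cont.
by move=> z; apply: product_bound; exact: gaussian_ge0.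
Qed.

Lemma integrable_cross2 :
  area_integrable (fun z => (v z * p z - u z * q z) * gaussian z).
Proof.
have [[cu cv cp cq] _] := huv.
apply: (integrable_dominated _ (area_integrableD intS intT)); first by cont.
move=> z; rewrite /normsq [u z ^+ 2 + _]addrC -(sqrrN (u z)) -mulNr.
by apply: product_bound; exact: gaussian_ge0.
Qed.

(** Real part of <f', f> = <f, z f>: the derivative in x of |f|^2 e^(-|z|^2) has
    integral zero. *)
Lemma adjoint_identity1 :
  \int[area R]_z ((u z * p z + v z * q z) * gaussian z) =
  \int[area R]_z (z.1 * (normsq u v z * gaussian z)).
Proof.
have [[cu cv cp cq] [ux vx uy vy]] := huv.
have := limit_relation (c1 := 1) (c2 := -2) (c3 := 2) (c4 := 0)
  (weight1_cvg intS) (weight_cvg integrable_coord1)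
  (weight_cvg integrable_cross1) (weight_cvg intS).
move=> H; suff : forall k, 1 *
   \int[area R]_(z in square (m k)) (weight1 (r_ k) z * (normsq u v z * gaussian z)) +
   -2 * \int[area R]_(z in square (m k)) (weight (r_ k) z * (z.1 * (normsq u v z * gaussian z))) +
   2 * \int[area R]_(z in square (m k)) (weight (r_ k) z * ((u z * p z + v z * q z) * gaussian z)) +
   0 * \int[area R]_(z in square (m k)) (weight (r_ k) z * (normsq u v z * gaussian z)) = 0.
  by move=> /H; lra.
move=> k.
have [cW cW1 cW2 cL] := cts_weights (r_ k).
have [b0 b1 b2] := cts_bump_fst (r_ k).
have [b0' b1' b2'] := cts_bump_snd (r_ k).
have ms : measurable (square (m k) : set plane) by exact: measurable_square.
have db := is_derive_bump (r_ k).
have Fx := partial1M (partial1_tensor (bump (r_ k)) db)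
  (partial1D (partial1M ux ux) (partial1M vx vx)).
have I := square_integral_partial1 (m0 k) _ Fx.
(* The combination is the integral of the derivative in x of psi |f|^2. *)
rewrite mul0r addr0 mul1r -!RintegralZl//; [|by apply: int_sq; cont..].
rewrite -!RintegralD//; [|by apply: int_sq; cont..].
rewrite -[RHS]I.
- by apply: eq_Rintegral => z _;
    rewrite /weight1 /weight /tensor /bump /bump1 /gaussian /normsq; ring.
- change (cts (fun z => tensor (bump1 (r_ k)) (bump (r_ k)) z * (u z * u z + v z * v z) +
    tensor (bump (r_ k)) (bump (r_ k)) z * (p z * u z + u z * p z + (q z * v z + v z * q z)))).
  by rewrite /tensor; cont.
- by move=> z zm; rewrite /tensor bump_boundary// mul0r mulr0 mul0r.
Qed.

(** Imaginary part of the same relation, with the derivative in y. *)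
Lemma adjoint_identity2 :
  \int[area R]_z ((v z * p z - u z * q z) * gaussian z) =
  \int[area R]_z (z.2 * (normsq u v z * gaussian z)).
Proof.
have [[cu cv cp cq] [ux vx uy vy]] := huv.
have := limit_relation (c1 := 1) (c2 := -2) (c3 := 2) (c4 := 0)
  (weight2_cvg intS) (weight_cvg integrable_coord2)
  (weight_cvg integrable_cross2) (weight_cvg intS).
move=> H; suff : forall k, 1 *
   \int[area R]_(z in square (m k)) (weight2 (r_ k) z * (normsq u v z * gaussian z)) +
   -2 * \int[area R]_(z in square (m k)) (weight (r_ k) z * (z.2 * (normsq u v z * gaussian z))) +
   2 * \int[area R]_(z in square (m k)) (weight (r_ k) z * ((v z * p z - u z * q z) * gaussian z)) +
   0 * \int[area R]_(z in square (m k)) (weight (r_ k) z * (normsq u v z * gaussian z)) = 0.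
  by move=> /H; lra.
move=> k.
have [cW cW1 cW2 cL] := cts_weights (r_ k).
have [b0 b1 b2] := cts_bump_fst (r_ k).
have [b0' b1' b2'] := cts_bump_snd (r_ k).
have ms : measurable (square (m k) : set plane) by exact: measurable_square.
have db := is_derive_bump (r_ k).
have Fy := partial2M (partial2_tensor (bump (r_ k)) db)
  (partial2D (partial2M uy uy) (partial2M vy vy)).
have I := square_integral_partial2 (m0 k) _ Fy.
rewrite mul0r addr0 mul1r -!RintegralZl//; [|by apply: int_sq; cont..].
rewrite -!RintegralD//; [|by apply: int_sq; cont..].
rewrite -[RHS]I.
- by apply: eq_Rintegral => z _;
    rewrite /weight2 /weight /tensor /bump /bump1 /gaussian /normsq; ring.
- change (cts (fun z => tensor (bump (r_ k)) (bump1 (r_ k)) z * (u z * u z + v z * v z) +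
    tensor (bump (r_ k)) (bump (r_ k)) z *
      (- q z * u z + u z * - q z + (p z * v z + v z * p z)))).
  by rewrite /tensor; cont.
- by move=> z zm; rewrite /tensor [bump _ z.2]bump_boundary// !mulr0 mul0r.
Qed.

End Identities.
End GaussianIdentities.

(** * From complex to partial derivatives *)

Section ComplexPlane.
Variable R : realType.
Implicit Types (z w : R[i]) (f : R[i] -> R[i]).
Notation Re := complex.Re.
Notation Im := complex.Im.

Lemma cabs_sqr z : cabs z ^+ 2 = Re z ^+ 2 + Im z ^+ 2.
Proof. by case: z => x y; rewrite /cabs /= sqr_sqrtr// addr_ge0 ?sqr_ge0. Qed.

Lemma cabs_ge0 z : 0 <= cabs z.
Proof. by case: z => x y; exact: sqrtr_ge0. Qed.

Lemma normr_cabs z : `|z| = (cabs z)%:C.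
Proof. by case: z => x y; rewrite normc_def. Qed.

Lemma ler_cabs_Re z : `|Re z| <= cabs z.
Proof.
by rewrite -ler_sqr ?nnegrE ?cabs_ge0// cabs_sqr real_normK ?num_real// lerDl sqr_ge0.
Qed.

Lemma ler_cabs_Im z : `|Im z| <= cabs z.
Proof.
by rewrite -ler_sqr ?nnegrE ?cabs_ge0// cabs_sqr real_normK ?num_real// lerDr sqr_ge0.
Qed.

Lemma ler_cabs z : cabs z <= `|Re z| + `|Im z|.
Proof.
rewrite -ler_sqr ?nnegrE ?cabs_ge0 ?addr_ge0// cabs_sqr sqrrD !real_normK ?num_real//.
by rewrite [leRHS]addrAC lerDl mulrn_wge0// mulr_ge0.
Qed.

Lemma ltcR_cabs z (e : R) : (`|z| < e%:C) = (cabs z < e).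
Proof. by rewrite normr_cabs ltcR. Qed.

Lemma gt0_complex (e : R[i]) : 0 < e -> exists2 d : R, 0 < d & e = d%:C.
Proof. by case: e => a b; rewrite ltcE/= => /andP[/eqP-> a0]; exists a. Qed.

Lemma entire_continuous f z (e : R) : entire f -> 0 < e ->
  exists2 d : R, 0 < d & forall w, cabs (w - z) < d -> cabs (f w - f z) < e.
Proof.
move=> ef e0.
have : {for z, continuous (f : R[i]^o -> R[i]^o)}.
  by apply: differentiable_continuous; apply/derivable1_diffP; exact: ef.
move=> /cvgrPdist_lt/(_ e%:C); rewrite ltcR => /(_ e0).
move=> /nbhs_ballP[d' /= /gt0_complex[d d0 ->] Hd].
exists d => // w wz; rewrite -ltcR_cabs distrC; apply: Hd.
by rewrite /ball/= distrC ltcR_cabs.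
Qed.

Lemma cderiv_limit f z (e : R) : entire f -> 0 < e ->
  exists2 d : R, 0 < d & forall h, h != 0 -> cabs h < d ->
    cabs (h^-1 * (f (h + z) - f z) - cderiv f z) < e.
Proof.
move=> ef e0.
have : h^-1 *: ((f : R[i]^o -> R[i]^o) (h *: 1 + z) - f z) @[h --> (0 : R[i]^o)^'] -->
    'D_1 (f : R[i]^o -> R[i]^o) z by exact: ef.
rewrite -derive1E => /cvgrPdist_lt/(_ e%:C); rewrite ltcR => /(_ e0).
move=> /nbhs_ballP[d' /= /gt0_complex[d d0 ->] Hd].
exists d => // h h0 hd; rewrite -ltcR_cabs distrC.
have := Hd h; rewrite /GRing.scale/= mulr1; apply => //.
by rewrite /ball/= sub0r normrN ltcR_cabs.
Qed.

Lemma is_derive_epsilon (F : R -> R) (x l : R) :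
  (forall e : R, 0 < e -> exists2 d : R, 0 < d & forall h, h != 0 -> `|h| < d ->
    `|h^-1 * (F (h + x) - F x) - l| < e) ->
  is_derive x (1 : R) F l.
Proof.
move=> H.
have : h^-1 *: (F (h *: 1 + x) - F x) @[h --> 0^'] --> l.
  apply/cvgrPdist_lt => e e0; have [d d0 Hd] := H e e0.
  apply/nbhs_ballP; exists d => // h /= hd h0.
  rewrite distrC /GRing.scale/= mulr1; apply: Hd => //.
  by move: hd; rewrite /ball/= sub0r normrN.
move=> cl; apply: DeriveDef; first by apply/cvg_ex; exists l.
exact: cvg_lim cl.
Qed.

(** The directions w = 1 and w = i give the two partial derivatives, and the
    Cauchy-Riemann equations. *)
Lemma entire_directional f z w (e : R) : entire f -> cabs w = 1 -> 0 < e ->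
  exists2 d : R, 0 < d & forall h : R, h != 0 -> `|h| < d ->
    cabs ((h^-1)%:C * (f (h%:C * w + z) - f z) - cderiv f z * w) < e.
Proof.
move=> ef w1 e0; have [d d0 Hd] := cderiv_limit z ef e0.
have w0 : w != 0.
  by apply/eqP => w0; move: w1; rewrite w0 /cabs Normc.normc0 => /eqP; rewrite eq_sym oner_eq0.
exists d => // h h0 hd.
have hw0 : h%:C * w != 0 by rewrite mulf_neq0// eq_complex/= negb_and h0.
have hC0 : h%:C != 0 by rewrite eq_complex/= negb_and h0.
have -> : (h^-1)%:C * (f (h%:C * w + z) - f z) - cderiv f z * w =
    ((h%:C * w)^-1 * (f (h%:C * w + z) - f z) - cderiv f z) * w.
  by rewrite fmorphV; field; rewrite hC0 w0.
rewrite /cabs Normc.normcM -/(cabs w) w1 mulr1; apply: Hd => //.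
rewrite /cabs Normc.normcM -/(cabs w) w1 mulr1 /=.
by rewrite expr0n addr0 sqrtr_sqr.
Qed.

Definition repart f (p : R * R) : R := Re (f (toC p)).
Definition impart f (p : R * R) : R := Im (f (toC p)).

Lemma ReB z w : Re (z - w) = Re z - Re w. Proof. by case: z w => a b [c d]. Qed.
Lemma ImB z w : Im (z - w) = Im z - Im w. Proof. by case: z w => a b [c d]. Qed.
Lemma ReZ (r : R) z : Re (r%:C * z) = r * Re z.
Proof. by case: z => a b; rewrite /= mul0r subr0. Qed.
Lemma ImZ (r : R) z : Im (r%:C * z) = r * Im z.
Proof. by case: z => a b; rewrite /= mul0r addr0. Qed.

Lemma cts_parts f : entire f -> cts (repart f) /\ cts (impart f).
Proof.
move=> ef; split=> p; apply/cvgrPdist_lt => e e0;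
  have [d d0 Hd] := entire_continuous (toC p) ef e0;
  apply: (iffRL (@nbhs_ballP R (R * R)%type p _));
  exists (d / 2); rewrite /= ?divr_gt0// => q [/= q1 q2].
- rewrite distrC /repart -ReB; apply: le_lt_trans (ler_cabs_Re _) _; apply: Hd.
  apply: le_lt_trans (ler_cabs _) _; rewrite /toC /=.
  by move: q1 q2; rewrite /ball/= (distrC p.1) (distrC p.2); lra.
- rewrite distrC /impart -ImB; apply: le_lt_trans (ler_cabs_Im _) _; apply: Hd.
  apply: le_lt_trans (ler_cabs _) _; rewrite /toC /=.
  by move: q1 q2; rewrite /ball/= (distrC p.1) (distrC p.2); lra.
Qed.

Lemma entire_partials f : entire f ->
  [/\ partial1 (repart f) (repart (cderiv f)),
      partial1 (impart f) (impart (cderiv f)),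
      partial2 (repart f) (fun t : R * R => - impart (cderiv f) t) &
      partial2 (impart f) (repart (cderiv f))].
Proof.
move=> ef.
have c1 : cabs (1 : R[i]) = 1 by rewrite /cabs Normc.normc1.
have ci : cabs ('i : R[i]) = 1 by rewrite /cabs /= expr0n expr1n add0r sqrtr1.
split=> x y; apply: is_derive_epsilon => e e0.
- have [d d0 Hd] := entire_directional (toC (x, y)) ef c1 e0.
  exists d => // h h0 hd; apply: le_lt_trans (Hd h h0 hd).
  apply: le_trans (ler_cabs_Re _); rewrite ReB ReZ ReB !mulr1.
  by rewrite (_ : h%:C + toC (x, y) = toC (h + x, y))// /toC/=; simpc.
- have [d d0 Hd] := entire_directional (toC (x, y)) ef c1 e0.
  exists d => // h h0 hd; apply: le_lt_trans (Hd h h0 hd).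
  apply: le_trans (ler_cabs_Im _); rewrite ImB ImZ ImB !mulr1.
  by rewrite (_ : h%:C + toC (x, y) = toC (h + x, y))// /toC/=; simpc.
- have [d d0 Hd] := entire_directional (toC (x, y)) ef ci e0.
  exists d => // h h0 hd; apply: le_lt_trans (Hd h h0 hd).
  apply: le_trans (ler_cabs_Re _); rewrite ReB ReZ ReB.
  rewrite (_ : h%:C * 'i + toC (x, y) = toC (x, h + y)); last by rewrite /toC/=; simpc.
  by rewrite /repart /impart; case: (cderiv _ _) => a b /=; simpc.
- have [d d0 Hd] := entire_directional (toC (x, y)) ef ci e0.
  exists d => // h h0 hd; apply: le_lt_trans (Hd h h0 hd).
  apply: le_trans (ler_cabs_Im _); rewrite ImB ImZ ImB.
  rewrite (_ : h%:C * 'i + toC (x, y) = toC (x, h + y)); last by rewrite /toC/=; simpc.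
  by rewrite /repart /impart; case: (cderiv _ _) => a b /=; simpc.
Qed.

Lemma entire_holomorphic_pair f : entire f -> entire (cderiv f) ->
  holomorphic_pair (repart f) (impart f) (repart (cderiv f)) (impart (cderiv f)).
Proof.
move=> ef ef'; have [cu cv] := cts_parts ef; have [cp cq] := cts_parts ef'.
by split => //; exact: entire_partials.
Qed.

End ComplexPlane.

(** * The uncertainty inequality *)

Section Uncertainty.
Variable R : realType.
Notation Re := complex.Re.
Notation Im := complex.Im.
Implicit Types (F G : R * R -> R) (z : R * R).

Lemma gauss_toC z : gauss (toC z) = gaussian z.
Proof.
rewrite /gauss /gaussian /bell -expRD; congr (_ * expR _).
by rewrite cabs_sqr /=; ring.
Qed.

Lemma normsq_parts f z : normsq (repart f) (impart f) z = cabs (f (toC z)) ^+ 2.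
Proof. by rewrite cabs_sqr. Qed.

Lemma L2_area_integrable f : entire f -> L2_lambda f ->
  area_integrable (fun z => normsq (repart f) (impart f) z * gaussian z).
Proof.
move=> ef [_ _ fin].
have [cu cv] := cts_parts ef; have cg := @cts_gaussian R.
apply/integrableP; split.
  apply/measurable_EFinP.
  apply: (@continuous_measurable_plane _
    (fun z => normsq (repart f) (impart f) z * gaussian z)).
  by change (cts (fun z => normsq (repart f) (impart f) z * gaussian z));
    rewrite /normsq; cont.
rewrite (_ : (\int[_]_z _ = \int[area R]_z (cabs (f (toC z)) ^+ 2 * gauss (toC z))%:E)%E)//.
apply: eq_integral => z _; rewrite /= gauss_toC normsq_parts ger0_norm//.
by rewrite mulr_ge0 ?sqr_ge0 ?gaussian_ge0.
Qed.

(** The Cauchy-Schwarz inequality for two vectors of square norms A and B, when the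
    real part of their inner product is - S. *)
Lemma quadratic_discriminant (A B S : R) : 0 < S ->
  (forall t, 0 <= A + t ^+ 2 * B - 2 * t * S) ->
  [/\ 0 < A, 0 < B & S ^+ 2 <= A * B].
Proof.
move=> S0 H.
have A0 : 0 <= A by have := H 0; rewrite expr0n /= mul0r mulr0 mul0r; lra.
have B0 : 0 < B.
  rewrite ltNge; apply/negP => B0.
  (* At this value of t, the linear term 2 t S exceeds A. *)
  have := H ((A + 1) / S).
  rewrite (_ : 2 * ((A + 1) / S) * S = 2 * (A + 1)); last by field; rewrite gt_eqF.
  have : ((A + 1) / S) ^+ 2 * B <= 0 by rewrite mulr_ge0_le0 ?sqr_ge0.
  lra.
have AB : S ^+ 2 <= A * B.
  have := H (S / B).
  rewrite (_ : A + (S / B) ^+ 2 * B - 2 * (S / B) * S = (A * B - S ^+ 2) / B); last first.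
    by field; rewrite gt_eqF.
  by rewrite pmulr_lge0 ?invr_gt0// subr_ge0.
split=> //; rewrite lt_neqAle A0 andbT; apply/eqP => A00.
by move: AB; rewrite -A00 mul0r leNgt exprn_gt0.
Qed.

(** A vector of square norm N, whose inner product with a vector of square norm S is c,
    has component of norm sqrt N sin(theta) orthogonal to that vector. *)
Lemma sqrt_sin_acos (N S c : R) : 0 < S -> 0 < N - c ^+ 2 / S ->
  Num.sqrt N * sin (acos (`|c| / (Num.sqrt N * Num.sqrt S))) =
  Num.sqrt (N - c ^+ 2 / S).
Proof.
move=> S0 h.
have c2 : 0 <= c ^+ 2 / S by rewrite divr_ge0 ?sqr_ge0// ltW.
have N0 : 0 < N by lra.
set x := _ / _.
have x0 : 0 <= x by rewrite divr_ge0// mulr_ge0 ?sqrtr_ge0.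
have x2 : x ^+ 2 = c ^+ 2 / S / N.
  rewrite /x expr_div_n exprMn !sqr_sqrtr ?ltW// real_normK ?num_real//.
  by field; rewrite !gt_eqF.
have x1 : x ^+ 2 <= 1 by rewrite x2 ler_pdivrMr// mul1r; lra.
have x1' : x <= 1 by rewrite -(ler_sqr x0) ?nnegrE// expr1n.
rewrite sin_acos; last by rewrite x1' andbT; lra.
rewrite -sqrtrM ?ltW// x2; congr Num.sqrt.
by field; rewrite !gt_eqF.
Qed.

Section Function.
Variable f : R[i] -> R[i].
Hypotheses (ef : entire f) (ef' : entire (cderiv f)).
Hypotheses (lf : L2_lambda f) (lf' : L2_lambda (cderiv f)).
Hypothesis f_neq0 : exists w : R[i], f w <> 0.

Let u := repart f.
Let v := impart f.
Let p := repart (cderiv f).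
Let q := impart (cderiv f).
Let huv : holomorphic_pair u v p q. Proof. exact: entire_holomorphic_pair. Qed.

(* Densities of |f|^2, |f'|^2, |z f|^2, z |f|^2 (real and imaginary part), of the real
   part and minus the imaginary part of f' conj(f), and of Re (f' conj(z f)). *)
Let fS z := normsq u v z * gaussian z.
Let fT z := normsq p q z * gaussian z.
Let fZ z := (z.1 ^+ 2 + z.2 ^+ 2) * (normsq u v z * gaussian z).
Let fX z := z.1 * (normsq u v z * gaussian z).
Let fY z := z.2 * (normsq u v z * gaussian z).
Let fC1 z := (u z * p z + v z * q z) * gaussian z.
Let fC2 z := (v z * p z - u z * q z) * gaussian z.
Let zf1 z := z.1 * u z - z.2 * v z.
Let zf2 z := z.1 * v z + z.2 * u z.
Let fM z := (p z * zf1 z + q z * zf2 z) * gaussian z.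

Let cts4 : [/\ cts u, cts v, cts p & cts q].
Proof. by have [] := huv. Qed.

Let iS : area_integrable fS. Proof. exact: L2_area_integrable. Qed.
Let iT : area_integrable fT. Proof. exact: L2_area_integrable. Qed.
Let iZ : area_integrable fZ. Proof. exact: (integrable_moment huv iS iT). Qed.
Let iX : area_integrable fX. Proof. exact: (integrable_coord1 huv iS iT). Qed.
Let iY : area_integrable fY. Proof. exact: (integrable_coord2 huv iS iT). Qed.
Let iC1 : area_integrable fC1. Proof. exact: (integrable_cross1 huv iS iT). Qed.
Let iC2 : area_integrable fC2. Proof. exact: (integrable_cross2 huv iS iT). Qed.
Let iM : area_integrable fM.
Proof.
have [cu cv cp cq] := cts4; have cg := @cts_gaussian R.
apply: (integrable_dominated _ (area_integrableD iT iZ)).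
  by change (cts fM); rewrite /fM /zf1 /zf2; cont.
move=> z; rewrite (_ : fZ z = (zf1 z ^+ 2 + zf2 z ^+ 2) * gaussian z).
  by apply: product_bound; exact: gaussian_ge0.
by rewrite /fZ /zf1 /zf2 /normsq; ring.
Qed.

Let S := \int[area R]_z fS z.
Let T := \int[area R]_z fT z.
Let Z := \int[area R]_z fZ z.
Let X := \int[area R]_z fX z.
Let Y := \int[area R]_z fY z.
Let M := \int[area R]_z fM z.

Let ZTS : Z = T + S. Proof. exact: (moment_identity huv iS iT). Qed.
Let C1X : \int[area R]_z fC1 z = X. Proof. exact: (adjoint_identity1 huv iS iT). Qed.
Let C2Y : \int[area R]_z fC2 z = Y. Proof. exact: (adjoint_identity2 huv iS iT). Qed.

(* Real and imaginary parts of (f' + z f - a f) + t (f' - z f - i b f). *)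
Let k1 (t a b : R) z := (1 + t) * p z + (1 - t) * zf1 z - (a * u z - t * b * v z).
Let k2 (t a b : R) z := (1 + t) * q z + (1 - t) * zf2 z - (a * v z + t * b * u z).
Let fK t a b z := normsq (k1 t a b) (k2 t a b) z * gaussian z.

Ltac intg := repeat first [assumption | apply: area_integrableD | apply: area_integrableZ].

Let fKE t a b : fK t a b =
  (fun z => (1 + t) ^+ 2 * fT z + ((1 - t) ^+ 2 * fZ z + ((a ^+ 2 + t ^+ 2 * b ^+ 2) * fS z +
   (2 * (1 - t ^+ 2) * fM z + ((- 2 * (1 + t) * a) * fC1 z + ((2 * (1 + t) * t * b) * fC2 z +
   ((- 2 * (1 - t) * a) * fX z + (- 2 * (1 - t) * t * b) * fY z))))))).
Proof.
apply/funext => z.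
by rewrite /fK /k1 /k2 /fT /fZ /fS /fM /fC1 /fC2 /fX /fY /zf1 /zf2 /normsq; ring.
Qed.

Let iK t a b : area_integrable (fK t a b).
Proof. by rewrite fKE; intg. Qed.

(* Square norms of f' + z f - a f and of f' - z f - i b f. *)
Let alpha a := T + Z + 2 * M - 4 * a * X + a ^+ 2 * S.
Let beta b := T + Z - 2 * M + 4 * b * Y + b ^+ 2 * S.

Let intK t a b : \int[area R]_z fK t a b z = alpha a + t ^+ 2 * beta b - 2 * t * S.
Proof.
rewrite fKE.
do 7 (rewrite area_RintegralD; [|by intg..]).
rewrite !area_RintegralZ// C1X C2Y -/S -/T -/Z -/M -/X -/Y /alpha /beta ZTS.
by ring.
Qed.

Let cts_K t a b : cts (fK t a b).
Proof.
have [cu cv cp cq] := cts4; have cg := @cts_gaussian R.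
by rewrite /fK /normsq /k1 /k2 /zf1 /zf2; cont.
Qed.

Let K_ge0 t a b z : 0 <= fK t a b z.
Proof. by rewrite mulr_ge0 ?gaussian_ge0// /normsq addr_ge0 ?sqr_ge0. Qed.

Let S_gt0 : 0 < S.
Proof.
have [cu cv _ _] := cts4; have cg := @cts_gaussian R.
have fS0 z : 0 <= fS z by rewrite mulr_ge0 ?gaussian_ge0// /normsq addr_ge0 ?sqr_ge0.
have S0 : 0 <= S by apply: Rintegral_ge0.
rewrite lt_neqAle S0 andbT; apply/eqP => S00.
have cS : cts fS by rewrite /fS /normsq; cont.
have iS0 : (\int[area R]_z (fS z)%:E = 0)%E.
  by rewrite -[LHS]fineK ?integrable_fin_num// -/(Rintegral _ _ _) -/S -S00.
have [w] := f_neq0; apply.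
have := continuous_integral0 cS fS0 iS0 (Re w, Im w).
move=> /eqP; rewrite mulf_eq0 (gt_eqF (gaussian_gt0 _)) orbF normsq_parts expf_eq0/=.
by move=> /eqP/Normc.eq0_normc; case: (w).
Qed.

Let parabola t a b : 0 <= alpha a + t ^+ 2 * beta b - 2 * t * S.
Proof. by rewrite -intK; exact: Rintegral_ge0. Qed.

(* The minima of [alpha] and [beta]. *)
Let A0 := T + Z + 2 * M - (2 * X) ^+ 2 / S.
Let B0 := T + Z - 2 * M - (2 * Y) ^+ 2 / S.

Let alphaE a : alpha a = A0 + S * (a - 2 * X / S) ^+ 2.
Proof. by rewrite /alpha /A0; field; rewrite gt_eqF. Qed.

Let betaE b : beta b = B0 + S * (b + 2 * Y / S) ^+ 2.
Proof. by rewrite /beta /B0; field; rewrite gt_eqF. Qed.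

Let disc : [/\ 0 < A0, 0 < B0 & S ^+ 2 <= A0 * B0].
Proof.
apply: quadratic_discriminant S_gt0 _ => t.
have := parabola t (2 * X / S) (- (2 * Y / S)).
by rewrite alphaE betaE subrr addNr expr0n /= mulr0 !addr0.
Qed.

Let lambda_intE (h : R[i] -> R) :
  lambda_int h = \int[area R]_z (h (toC z) * gaussian z).
Proof. by apply: eq_Rintegral => z _; rewrite gauss_toC. Qed.

Let normE : fock_norm f = Num.sqrt S.
Proof.
rewrite /fock_norm lambda_intE; congr Num.sqrt.
by apply: eq_Rintegral => z _; rewrite -normsq_parts.
Qed.

Let plus_parts z : deriv_plus f (toC z) = (p z + zf1 z) +i* (q z + zf2 z).
Proof.
rewrite /deriv_plus /p /q /zf1 /zf2 /u /v /repart /impart.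
by case: (cderiv f _) => a b; case: (f _) => c d; simpc.
Qed.

Let minus_parts z : deriv_minus f (toC z) = (p z - zf1 z) +i* (q z - zf2 z).
Proof.
rewrite /deriv_minus /p /q /zf1 /zf2 /u /v /repart /impart.
by case: (cderiv f _) => a b; case: (f _) => c d; simpc.
Qed.

Let f_parts z : f (toC z) = u z +i* v z.
Proof. by rewrite /u /v /repart /impart; case: (f _). Qed.

Let norm_plus : fock_norm (deriv_plus f) = Num.sqrt (T + Z + 2 * M).
Proof.
rewrite /fock_norm lambda_intE; congr Num.sqrt.
rewrite -addrA -(area_RintegralZ 2 iM) -area_RintegralD; [|by intg..].
rewrite -area_RintegralD; [|by intg..].
apply: eq_Rintegral => z _; rewrite cabs_sqr plus_parts /=.
by rewrite /fT /fZ /fM /zf1 /zf2 /normsq; ring.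
Qed.

Let norm_minus : fock_norm (deriv_minus f) = Num.sqrt (T + Z - 2 * M).
Proof.
rewrite /fock_norm lambda_intE; congr Num.sqrt.
rewrite -addrA -mulNr -(area_RintegralZ (- 2) iM) -area_RintegralD; [|by intg..].
rewrite -area_RintegralD; [|by intg..].
apply: eq_Rintegral => z _; rewrite cabs_sqr minus_parts /=.
by rewrite /fT /fZ /fM /zf1 /zf2 /normsq; ring.
Qed.

Let inner_plus : cabs (fock_inner (deriv_plus f) f) = `|2 * X|.
Proof.
rewrite /fock_inner !lambda_intE.
rewrite (_ : \int[area R]_z (Re _ * _) = 2 * X); last first.
  rewrite mulr2n mulrDl mul1r -[X in X + _]C1X -area_RintegralD//; apply: eq_Rintegral => z _.
  by rewrite plus_parts f_parts /fC1 /fX /zf1 /zf2 /normsq /=; ring.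
rewrite (_ : \int[area R]_z (Im _ * _) = 0); last first.
  rewrite -(addNr Y) -[X in - X + _]C2Y -mulN1r -area_RintegralZ// -area_RintegralD//; last by intg.
  apply: eq_Rintegral => z _.
  by rewrite plus_parts f_parts /fC2 /fY /zf1 /zf2 /normsq /=; ring.
by rewrite /cabs /= expr0n addr0 sqrtr_sqr.
Qed.

Let inner_minus : cabs (fock_inner (deriv_minus f) f) = `|2 * Y|.
Proof.
rewrite /fock_inner !lambda_intE.
rewrite (_ : \int[area R]_z (Re _ * _) = 0); last first.
  rewrite -(subrr X) -[X in X - _]C1X -mulN1r -area_RintegralZ// -area_RintegralD//; last by intg.
  apply: eq_Rintegral => z _.
  by rewrite minus_parts f_parts /fC1 /fX /zf1 /zf2 /normsq /=; ring.
rewrite (_ : \int[area R]_z (Im _ * _) = - (2 * Y)); last first.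
  have -> : - (2 * Y) = (-1) * (\int[area R]_z fC2 z) + (-1) * Y by rewrite C2Y; ring.
  rewrite -!area_RintegralZ// -area_RintegralD; [|by intg..]; apply: eq_Rintegral => z _.
  by rewrite minus_parts f_parts /fC2 /fY /zf1 /zf2 /normsq /=; ring.
by rewrite /cabs /= expr0n add0r sqrtr_sqr normrN.
Qed.

Let lhsE : uncertainty_lhs f = (Num.sqrt A0 * Num.sqrt B0)%:E.
Proof.
have [A0_gt0 B0_gt0 _] := disc.
rewrite /uncertainty_lhs asboolT//; congr EFin.
rewrite /fock_angle inner_plus inner_minus norm_plus norm_minus normE.
rewrite -(sqrt_sin_acos S_gt0 A0_gt0) -(sqrt_sin_acos S_gt0 B0_gt0) normrM.
set sA := sin _; set sB := sin _.
have sA0 : 0 <= sA.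
  have := sqrtr_ge0 A0; rewrite -(sqrt_sin_acos S_gt0 A0_gt0) -/sA pmulr_rge0// sqrtr_gt0.
  have : 0 <= (2 * X) ^+ 2 / S by rewrite divr_ge0 ?sqr_ge0// ltW.
  by move: A0_gt0; rewrite /A0; lra.
have sB0 : 0 <= sB.
  have := sqrtr_ge0 B0; rewrite -(sqrt_sin_acos S_gt0 B0_gt0) -/sB pmulr_rge0// sqrtr_gt0.
  have : 0 <= (2 * Y) ^+ 2 / S by rewrite divr_ge0 ?sqr_ge0// ltW.
  by move: B0_gt0; rewrite /B0; lra.
by rewrite (ger0_norm sA0) (ger0_norm sB0); ring.
Qed.

Lemma fock_uncertainty : ((fock_norm f ^+ 2)%:E <= uncertainty_lhs f)%E.
Proof.
have [A0_gt0 B0_gt0 AB] := disc.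
rewrite lhsE lee_fin normE (sqr_sqrtr (ltW S_gt0)) -(sqrtrM _ (ltW A0_gt0)).
apply: (@le_trans _ _ (Num.sqrt (S ^+ 2))); first by rewrite sqrtr_sqr gtr0_norm.
by rewrite ler_sqrt// mulr_ge0// ltW.
Qed.

Let f'_parts z : cderiv f (toC z) = p z +i* q z.
Proof. by rewrite /p /q /repart /impart; case: (cderiv f _). Qed.

(** The two vectors of the uncertainty inequality are linearly dependent:
    f' + z f - a f = - c (f' - z f - i b f). *)
Definition extremal (c a b : R) (g : R[i] -> R[i]) := forall w,
  (1 + c)%:C * cderiv g w + ((1 - c)%:C * w - (a +i* (c * b))) * g w = 0.

Let extremalE c a b : extremal c a b f <-> forall z, fK c a b z = 0.
Proof.
split=> H.
  move=> z; have := H (toC z); rewrite f_parts f'_parts /toC; simpc => -[h1 h2].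
  rewrite /fK /normsq /k1 /k2 /zf1 /zf2.
  have -> : (1 + c) * p z + (1 - c) * (z.1 * u z - z.2 * v z) - (a * u z - c * b * v z) = 0.
    by rewrite -[RHS]h1; ring.
  have -> : (1 + c) * q z + (1 - c) * (z.1 * v z + z.2 * u z) - (a * v z + c * b * u z) = 0.
    by rewrite -[RHS]h2; ring.
  by rewrite expr0n addr0 mul0r.
move=> w; have := H (Re w, Im w).
rewrite /fK => /eqP; rewrite mulf_eq0 (gt_eqF (gaussian_gt0 _)) orbF /normsq.
rewrite paddr_eq0 ?sqr_ge0// !expf_eq0/= => /andP[/eqP h1 /eqP h2].
have -> : w = toC (Re w, Im w) by case: (w).
rewrite f_parts f'_parts; move: h1 h2; rewrite /k1 /k2 /zf1 /zf2 /toC /= => h1 h2.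
simpc; congr (_ +i* _); [rewrite -[RHS]h1|rewrite -[RHS]h2]; ring.
Qed.

(** In case of equality the quadratic in t attains the value zero, at t = c; it is the
    integral of a continuous nonnegative function, which then vanishes everywhere.
    Conversely a zero of the quadratic at some c > 0 and some a, b forces the reverse
    inequality by the arithmetic-geometric mean inequality. *)
Lemma fock_uncertainty_eq : uncertainty_lhs f = (fock_norm f ^+ 2)%:E <->
  exists c a b, 0 < c /\ extremal c a b f.
Proof.
have [A0_gt0 B0_gt0 AB] := disc.
rewrite lhsE normE sqr_sqrtr ?ltW//; split.
  move=> [AB_S].
  have ABS : A0 * B0 = S ^+ 2.
    by rewrite -AB_S exprMn !sqr_sqrtr ?ltW.
  exists (S / B0), (2 * X / S), (- (2 * Y / S)); split; first by rewrite divr_gt0.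
  apply/extremalE; apply: continuous_integral0.
  - exact: cts_K.
  - exact: K_ge0.
  - rewrite -[LHS]fineK; last exact: (integrable_fin_num _ (iK _ _ _)).
    rewrite -/(Rintegral _ _ _) intK alphaE betaE subrr addNr expr0n /= mulr0 !addr0.
    congr EFin; rewrite (_ : _ + _ - _ = (A0 * B0 - S ^+ 2) / B0); last first.
      by field; rewrite gt_eqF.
    by rewrite ABS subrr mul0r.
move=> [c [a [b [c0 /extremalE K0]]]]; congr EFin.
have : \int[area R]_z fK c a b z = 0.
  by rewrite /Rintegral integral0_eq// => z _; rewrite K0.
rewrite intK alphaE betaE => AB0.
have sa : 0 <= S * (a - 2 * X / S) ^+ 2 by rewrite mulr_ge0 ?sqr_ge0// ltW.
have sb : 0 <= c ^+ 2 * (S * (b + 2 * Y / S) ^+ 2).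
  by rewrite mulr_ge0 ?sqr_ge0// mulr_ge0 ?sqr_ge0// ltW.
set x := Num.sqrt A0; set y := Num.sqrt B0.
have xA : x ^+ 2 = A0 by rewrite sqr_sqrtr ?ltW.
have yB : y ^+ 2 = B0 by rewrite sqr_sqrtr ?ltW.
have : 0 <= (x - c * y) ^+ 2 by exact: sqr_ge0.
rewrite sqrrB exprMn xA yB => xy.
have xyS : x * y <= S.
  rewrite -(ler_pM2l c0).
  have -> : c * (x * y) = x * (c * y) by ring.
  by move: AB0 xy; rewrite mulrDr mulr2n; lra.
apply/eqP; rewrite eq_le xyS/= /x /y -(sqrtrM _ (ltW A0_gt0)).
apply: (@le_trans _ _ (Num.sqrt (S ^+ 2))); first by rewrite sqrtr_sqr gtr0_norm.
by rewrite ler_sqrt// mulr_ge0// ltW.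
Qed.

End Function.
End Uncertainty.

(** * Gaussian tails *)

Section GaussianBound.
Variable R : realType.
Local Notation plane := (plane R).
Implicit Types (k b x : R) (z : R * R).

(** The polynomial and the linear term of the exponent are each absorbed by a quarter
    of the quadratic term; what is left is a centred normal density. *)
Lemma gaussian_tail_bound k b : 0 < k ->
  exists s M : R, [/\ s != 0, 0 <= M &
    forall x, (1 + x ^+ 2) * expR (- k * x ^+ 2 + b * x) <= M * normal_pdf 0 s x].
Proof.
move=> k0.
pose s := (Num.sqrt k)^-1.
have sk : s ^+ 2 = k^-1 by rewrite exprVn sqr_sqrtr// ltW.
have s0 : s != 0 by rewrite invr_eq0 sqrtr_eq0 -ltNge.
pose d := k / 4.
have d0 : 0 < d by rewrite divr_gt0.
have np0 := normal_peak_gt0 s0.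
exists s, ((1 + d^-1) * expR (b ^+ 2 / (4 * d)) / normal_peak s); split => //.
  apply: divr_ge0; last exact: ltW.
  by apply: mulr_ge0; [rewrite addr_ge0// invr_ge0 ltW|exact: expR_ge0].
move=> x; rewrite normal_pdfE// [leRHS](_ : _ = (1 + d^-1) *
    (expR (b ^+ 2 / (4 * d)) * expR (- (k / 2) * x ^+ 2))); last first.
  rewrite /normal_fun subr0 sk (_ : - x ^+ 2 / (k^-1 *+ 2) = - (k / 2) * x ^+ 2).
    by field; rewrite !gt_eqF.
  by rewrite -mulr_natr; field; rewrite gt_eqF.
have h1 : 1 + x ^+ 2 <= (1 + d^-1) * expR (d * x ^+ 2).
  have := expR_ge1Dx (d * x ^+ 2).
  have dx : 0 <= d * x ^+ 2 by rewrite mulr_ge0 ?sqr_ge0// ltW.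
  move: (expR _) => E hE.
  have : d^-1 * (d * x ^+ 2) <= d^-1 * E by rewrite ler_wpM2l ?invr_ge0 ?ltW//; lra.
  by rewrite mulrA mulVf ?gt_eqF// mul1r mulrDl mul1r; lra.
have h2 : b * x <= d * x ^+ 2 + b ^+ 2 / (4 * d).
  have := sqr_ge0 (2 * d * x - b).
  have -> : d * x ^+ 2 + b ^+ 2 / (4 * d) = b * x + (2 * d * x - b) ^+ 2 / (4 * d).
    by field; rewrite gt_eqF.
  by move=> h; rewrite lerDl divr_ge0// mulr_ge0// ltW.
have h3 : expR (- k * x ^+ 2 + b * x) <=
    expR (b ^+ 2 / (4 * d)) * expR (- (k / 2) * x ^+ 2) * expR (- (d * x ^+ 2)).
  rewrite -!expRD ler_expR.
  have -> : k = 4 * d by rewrite /d; field.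
  by move: h2; set y := x ^+ 2; set w := b ^+ 2 / _; lra.
apply: (le_trans (ler_pM _ (expR_ge0 _) h1 h3)); first by rewrite addr_ge0 ?sqr_ge0.
rewrite [leLHS](_ : _ = (1 + d^-1) * (expR (b ^+ 2 / (4 * d)) * expR (- (k / 2) * x ^+ 2)) *
  (expR (d * x ^+ 2) * expR (- (d * x ^+ 2)))); last by ring.
by rewrite -(expRD (d * x ^+ 2)) subrr expR0 mulr1.
Qed.

Lemma integral_normal_product (s1 s2 : R) :
  (\int[area R]_z (normal_pdf 0 s1 z.1 * normal_pdf 0 s2 z.2)%:E = 1)%E.
Proof.
rewrite (_ : (\int[area R]_z _)%E = (\int[lebesgue_measure]_x \int[lebesgue_measure]_y
   (normal_pdf 0 s1 x * normal_pdf 0 s2 y)%:E)%E); last first.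
  apply: (@fubini_tonelli1 _ _ (measurableTypeR R) (measurableTypeR R) R
     lebesgue_measure lebesgue_measure
     (fun z => (normal_pdf 0 s1 z.1 * normal_pdf 0 s2 z.2)%:E)).
    apply/measurable_EFinP; apply: measurable_funM.
      exact: (measurableT_comp (measurable_normal_pdf 0 s1) measurable_fst).
    exact: (measurableT_comp (measurable_normal_pdf 0 s2) measurable_snd).
  by move=> z; rewrite lee_fin mulr_ge0 ?normal_pdf_ge0.
rewrite -[RHS](integral_normal_pdf 0 s1); apply: eq_integral => x _.
under eq_integral do rewrite EFinM.
rewrite ge0_integralZl_EFin ?normal_pdf_ge0//.
- by rewrite integral_normal_pdf mule1.
- by move=> y _; rewrite lee_fin normal_pdf_ge0.
- by apply/measurable_EFinP; exact: measurable_normal_pdf.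
Qed.

Lemma gaussian_finite (k1 b1 k2 b2 K : R) (F : R * R -> R) : 0 < k1 -> 0 < k2 ->
  cts F -> (forall z, 0 <= F z) -> 0 <= K ->
  (forall z, F z <= K * ((1 + z.1 ^+ 2) * expR (- k1 * z.1 ^+ 2 + b1 * z.1)) *
     ((1 + z.2 ^+ 2) * expR (- k2 * z.2 ^+ 2 + b2 * z.2))) ->
  (\int[area R]_z (F z)%:E < +oo)%E.
Proof.
move=> k10 k20 cF F0 K0 FK.
have [s1 [M1 [s10 M10 H1]]] := gaussian_tail_bound b1 k10.
have [s2 [M2 [s20 M20 H2]]] := gaussian_tail_bound b2 k20.
pose N z := normal_pdf 0 s1 z.1 * normal_pdf 0 s2 z.2.
have N0 z : 0 <= N z by rewrite mulr_ge0 ?normal_pdf_ge0.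
have mN : measurable_fun [set: plane] N.
  apply: measurable_funM.
    exact: (measurableT_comp (measurable_normal_pdf 0 s1) measurable_fst).
  exact: (measurableT_comp (measurable_normal_pdf 0 s2) measurable_snd).
apply: (@le_lt_trans _ _ (\int[area R]_z ((K * M1 * M2)%:E * (N z)%:E))%E).
  apply: ge0_le_integral => //.
  - by move=> z _; rewrite lee_fin.
  - by apply/measurable_EFinP; exact: continuous_measurable_plane cF.
  - by apply/measurable_EFinP; exact: measurable_funM.
  - move=> z _; rewrite -EFinM lee_fin; apply: le_trans (FK z) _.
    rewrite (_ : K * M1 * M2 * N z = K * (M1 * normal_pdf 0 s1 z.1) * (M2 * normal_pdf 0 s2 z.2)).
      have nn k b x : 0 <= (1 + x ^+ 2) * expR (- k * x ^+ 2 + b * x).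
        by rewrite mulr_ge0 ?expR_ge0// addr_ge0 ?sqr_ge0.
      by apply: ler_pM; [exact: mulr_ge0|exact: nn|exact: ler_wpM2l|exact: H2].
    by rewrite /N; ring.
rewrite ge0_integralZl_EFin ?mulr_ge0//.
- by rewrite integral_normal_product mule1 ltry.
- by move=> z _; rewrite lee_fin.
- exact/measurable_EFinP.
Qed.

End GaussianBound.

(** * Exponentials of quadratic polynomials *)

Section Exponential.
Variable R : realType.
Notation Re := complex.Re.
Notation Im := complex.Im.
Implicit Types (al x y : R) (z : R * R) (f : R[i] -> R[i]).

Definition phi1 al (b1 b2 : R) z := al * (z.1 ^+ 2 - z.2 ^+ 2) + b1 * z.1 - b2 * z.2.
Definition phi2 al (b1 b2 : R) z := 2 * al * z.1 * z.2 + b1 * z.2 + b2 * z.1.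
Definition ex1 al (b1 b2 : R) z := expR (phi1 al b1 b2 z) * cos (phi2 al b1 b2 z).
Definition ex2 al (b1 b2 : R) z := expR (phi1 al b1 b2 z) * sin (phi2 al b1 b2 z).
Definition slope1 al (b1 : R) z := 2 * al * z.1 + b1.
Definition slope2 al (b2 : R) z := 2 * al * z.2 + b2.

Lemma cexp_quadratic al b1 b2 z :
  cexp (al%:C * toC z ^+ 2 + (b1 +i* b2) * toC z) = ex1 al b1 b2 z +i* ex2 al b1 b2 z.
Proof.
rewrite /cexp /ex1 /ex2.
have -> : al%:C * toC z ^+ 2 + (b1 +i* b2) * toC z = phi1 al b1 b2 z +i* phi2 al b1 b2 z.
  rewrite /toC /phi1 /phi2 expr2; simpc.
  by congr (_ +i* _); ring.
by simpc.
Qed.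

Lemma is_derive_exp_cos (g h : R -> R) x dg dh :
  is_derive x (1 : R) g dg -> is_derive x (1 : R) h dh ->
  is_derive x (1 : R) (fun t => expR (g t) * cos (h t))
    (dg * (expR (g x) * cos (h x)) - dh * (expR (g x) * sin (h x))).
Proof.
move=> hg hh.
have d1 := @is_derive1_comp _ expR g x _ _ (is_derive_expR (g x)) hg.
have d2 := @is_derive1_comp _ cos h x _ _ (is_derive_cos (h x)) hh.
by apply: (is_derive_eq (is_derive_mul d1 d2)); rewrite /=; ring.
Qed.

Lemma is_derive_exp_sin (g h : R -> R) x dg dh :
  is_derive x (1 : R) g dg -> is_derive x (1 : R) h dh ->
  is_derive x (1 : R) (fun t => expR (g t) * sin (h t))
    (dg * (expR (g x) * sin (h x)) + dh * (expR (g x) * cos (h x))).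
Proof.
move=> hg hh.
have d1 := @is_derive1_comp _ expR g x _ _ (is_derive_expR (g x)) hg.
have d2 := @is_derive1_comp _ sin h x _ _ (is_derive_sin (h x)) hh.
by apply: (is_derive_eq (is_derive_mul d1 d2)); rewrite /=; ring.
Qed.

Lemma is_derive_quadratic (c2 c1 c0 x : R) :
  is_derive x 1 (fun t => c2 * t ^+ 2 + c1 * t + c0) (2 * c2 * x + c1).
Proof.
have dx := is_derive_id x (1 : R).
have d := is_deriveD (is_deriveD (is_derive_mul (is_derive_cst c2 x 1) (is_derive_mul dx dx))
  (is_derive_mul (is_derive_cst c1 x 1) dx)) (is_derive_cst c0 x 1).
by apply: (is_derive_eq d); rewrite /=; ring.
Qed.

Section Partials.
Variables al b1 b2 : R.
Let e1 := ex1 al b1 b2.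
Let e2 := ex2 al b1 b2.
Let d1 := slope1 al b1.
Let d2 := slope2 al b2.

Let phi1_1 x y : is_derive x 1 (fun t => phi1 al b1 b2 (t, y)) (d1 (x, y)).
Proof.
have -> : (fun t => phi1 al b1 b2 (t, y)) =
    (fun t => al * t ^+ 2 + b1 * t + (- al * y ^+ 2 - b2 * y)).
  by apply/funext => t; rewrite /phi1 /=; ring.
exact: is_derive_quadratic.
Qed.

Let phi1_2 x y : is_derive y 1 (fun t => phi1 al b1 b2 (x, t)) (- d2 (x, y)).
Proof.
have -> : (fun t => phi1 al b1 b2 (x, t)) =
    (fun t => (- al) * t ^+ 2 + (- b2) * t + (al * x ^+ 2 + b1 * x)).
  by apply/funext => t; rewrite /phi1 /=; ring.
by apply: (is_derive_eq (is_derive_quadratic _ _ _ _)); rewrite /d2 /slope2 /=; ring.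
Qed.

Let phi2_1 x y : is_derive x 1 (fun t => phi2 al b1 b2 (t, y)) (d2 (x, y)).
Proof.
have -> : (fun t => phi2 al b1 b2 (t, y)) =
    (fun t => 0 * t ^+ 2 + (2 * al * y + b2) * t + b1 * y).
  by apply/funext => t; rewrite /phi2 /=; ring.
by apply: (is_derive_eq (is_derive_quadratic _ _ _ _)); rewrite /d2 /slope2 /=; ring.
Qed.

Let phi2_2 x y : is_derive y 1 (fun t => phi2 al b1 b2 (x, t)) (d1 (x, y)).
Proof.
have -> : (fun t => phi2 al b1 b2 (x, t)) =
    (fun t => 0 * t ^+ 2 + (2 * al * x + b1) * t + b2 * x).
  by apply/funext => t; rewrite /phi2 /=; ring.
by apply: (is_derive_eq (is_derive_quadratic _ _ _ _)); rewrite /d1 /slope1 /=; ring.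
Qed.

Lemma exponential_partials :
  [/\ partial1 e1 (fun z => d1 z * e1 z - d2 z * e2 z),
      partial1 e2 (fun z => d1 z * e2 z + d2 z * e1 z),
      partial2 e1 (fun z => - (d1 z * e2 z + d2 z * e1 z)) &
      partial2 e2 (fun z => d1 z * e1 z - d2 z * e2 z)].
Proof.
split=> x y.
- exact: (is_derive_exp_cos (phi1_1 x y) (phi2_1 x y)).
- exact: (is_derive_exp_sin (phi1_1 x y) (phi2_1 x y)).
- apply: (is_derive_eq (is_derive_exp_cos (phi1_2 x y) (phi2_2 x y))).
  by rewrite /e1 /e2 /ex1 /ex2 /=; ring.
- apply: (is_derive_eq (is_derive_exp_sin (phi1_2 x y) (phi2_2 x y))).
  by rewrite /e1 /e2 /ex1 /ex2 /=; ring.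
Qed.

End Partials.

Lemma partials0_cst (g : R * R -> R) :
  partial1 g (fun=> 0) -> partial2 g (fun=> 0) -> forall z, g z = g (0, 0).
Proof.
move=> g1 g2 [x y].
transitivity (g (0, y)).
  exact: (@is_derive_0_is_cst _ (fun t => g (t, y)) x 0 (g1^~ y)).
exact: (@is_derive_0_is_cst _ (fun t => g (0, t)) y 0 (g2 0)).
Qed.

Lemma toC_surj (w : R[i]) : exists z, w = toC z.
Proof. by case: w => x y; exists (x, y). Qed.

(** The product of f with the exponential of the opposite polynomial has zero partial
    derivatives, hence is constant. *)
Lemma logarithmic_derivative f al b1 b2 : entire f ->
  (forall w, cderiv f w = ((2 * al)%:C * w + (b1 +i* b2)) * f w) ->
  exists C : R[i], forall w, f w = C * cexp (al%:C * w ^+ 2 + (b1 +i* b2) * w).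
Proof.
move=> ef f'E.
have [ux vx uy vy] := entire_partials ef.
pose u := repart f; pose v := impart f.
pose d1 := slope1 al b1; pose d2 := slope2 al b2.
have f_parts z : f (toC z) = u z +i* v z by rewrite /u /v /repart /impart; case: (f _).
have f'_parts z : cderiv f (toC z) = (d1 z * u z - d2 z * v z) +i* (d1 z * v z + d2 z * u z).
  rewrite f'E f_parts /toC /d1 /d2 /slope1 /slope2; simpc.
  by congr (_ +i* _); ring.
have pE z : repart (cderiv f) z = d1 z * u z - d2 z * v z by rewrite /repart f'_parts.
have qE z : impart (cderiv f) z = d1 z * v z + d2 z * u z by rewrite /impart f'_parts.
pose n1 := ex1 (- al) (- b1) (- b2); pose n2 := ex2 (- al) (- b1) (- b2).
have [n1x n2x n1y n2y] := exponential_partials (- al) (- b1) (- b2).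
rewrite -/n1 -/n2 in n1x n2x n1y n2y.
have s1 z : slope1 (- al) (- b1) z = - d1 z by rewrite /d1 /slope1; ring.
have s2 z : slope2 (- al) (- b2) z = - d2 z by rewrite /d2 /slope2; ring.
pose g1 z := u z * n1 z - v z * n2 z.
pose g2 z := u z * n2 z + v z * n1 z.
have g1c : forall z, g1 z = g1 (0, 0).
  apply: partials0_cst => x y.
  - apply: (is_derive_eq ((partial1D (partial1M ux n1x) (partial1N (partial1M vx n2x))) x y)).
    by rewrite pE qE s1 s2 /u /v; ring.
  - apply: (is_derive_eq ((partial2D (partial2M uy n1y) (partial2N (partial2M vy n2y))) x y)).
    by rewrite pE qE s1 s2 /u /v; ring.
have g2c : forall z, g2 z = g2 (0, 0).
  apply: partials0_cst => x y.
  - apply: (is_derive_eq ((partial1D (partial1M ux n2x) (partial1M vx n1x)) x y)).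
    by rewrite pE qE s1 s2 /u /v; ring.
  - apply: (is_derive_eq ((partial2D (partial2M uy n2y) (partial2M vy n1y)) x y)).
    by rewrite pE qE s1 s2 /u /v; ring.
exists (g1 (0, 0) +i* g2 (0, 0)) => w; have [z ->] := toC_surj w.
rewrite cexp_quadratic f_parts -(g1c z) -(g2c z) /g1 /g2.
have p1 : phi1 (- al) (- b1) (- b2) z = - phi1 al b1 b2 z by rewrite /phi1; ring.
have p2 : phi2 (- al) (- b1) (- b2) z = - phi2 al b1 b2 z by rewrite /phi2; ring.
rewrite /n1 /n2 /ex1 /ex2 p1 p2 cosN sinN.
have EE : expR (- phi1 al b1 b2 z) * expR (phi1 al b1 b2 z) = 1.
  by rewrite -expRD addNr expR0.
have CS := cos2Dsin2 (phi2 al b1 b2 z).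
move: (expR _) (expR _) (cos _) (sin _) EE CS => E' E c s EE CS.
have H : E * E' * (c ^+ 2 + s ^+ 2) = 1 by rewrite EE CS mulr1.
simpc; congr (_ +i* _).
  by rewrite -[LHS]mulr1 -[X in _ * X]H; ring.
by rewrite -[LHS]mulr1 -[X in _ * X]H; ring.
Qed.

Lemma is_derive_unique (g : R -> R) x l1 l2 :
  is_derive x (1 : R) g l1 -> is_derive x (1 : R) g l2 -> l1 = l2.
Proof. by move=> h1 h2; rewrite -(@derive_val _ _ _ _ _ _ _ h1) (@derive_val _ _ _ _ _ _ _ h2). Qed.

(** Since f is entire, its derivative is its partial derivative in x, which is read off
    the real formula for the exponential. *)
Lemma cderiv_exponential f al b1 b2 (C : R[i]) : entire f ->
  (forall w, f w = C * cexp (al%:C * w ^+ 2 + (b1 +i* b2) * w)) ->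
  forall w, cderiv f w = ((2 * al)%:C * w + (b1 +i* b2)) * f w.
Proof.
move=> ef fE w; have [[x y] ->] := toC_surj w.
have [ux vx _ _] := entire_partials ef.
have [e1x e2x _ _] := exponential_partials al b1 b2.
case: C fE => C1 C2 fE.
have uE : repart f = (fun z => C1 * ex1 al b1 b2 z - C2 * ex2 al b1 b2 z).
  by apply/funext => z; rewrite /repart fE cexp_quadratic; simpc.
have vE : impart f = (fun z => C1 * ex2 al b1 b2 z + C2 * ex1 al b1 b2 z).
  by apply/funext => z; rewrite /impart fE cexp_quadratic; simpc.
have cst1 (c : R) : partial1 (fun=> c) (fun=> 0) by move=> a b; exact: is_derive_cst.
have := ux x y; rewrite uE => hu.
have := vx x y; rewrite vE => hv.
have pE := is_derive_unique hu
  ((partial1D (partial1M (cst1 C1) e1x) (partial1N (partial1M (cst1 C2) e2x))) x y).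
have qE := is_derive_unique hv
  ((partial1D (partial1M (cst1 C1) e2x) (partial1M (cst1 C2) e1x)) x y).
have -> : cderiv f (toC (x, y)) = repart (cderiv f) (x, y) +i* impart (cderiv f) (x, y).
  by rewrite /repart /impart; case: (cderiv f _).
rewrite pE qE fE cexp_quadratic /slope1 /slope2 /toC; simpc.
by congr (_ +i* _); ring.
Qed.

Lemma entire_cderiv_exponential f al b1 b2 : entire f ->
  (forall w, cderiv f w = ((2 * al)%:C * w + (b1 +i* b2)) * f w) ->
  entire (cderiv f).
Proof.
move=> ef f'E w.
have -> : cderiv f = (((fun t => (2 * al)%:C) : R[i]^o -> R[i]^o) * id +
    (fun t => b1 +i* b2)) * (f : R[i]^o -> R[i]^o) by apply/funext.
apply: derivableM; last exact: ef.
apply: derivableD; last exact: derivable_cst.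
by apply: derivableM; [exact: derivable_cst|exact: derivable_id].
Qed.

Lemma cabsM (w t : R[i]) : cabs (w * t) = cabs w * cabs t.
Proof. exact: Normc.normcM. Qed.

(** Up to the factor |f' / f|^2, of degree two, the square of |f'| times the Gaussian
    density is the exponential of
    - (1 - 2 al) x^2 - (1 + 2 al) y^2 + 2 b1 x - 2 b2 y, where both quadratic
    coefficients are negative. *)
Lemma fock_cderiv_exponential f al b1 b2 (C : R[i]) : entire f ->
  - 1 < 2 * al < 1 ->
  (forall w, f w = C * cexp (al%:C * w ^+ 2 + (b1 +i* b2) * w)) ->
  fock (cderiv f).
Proof.
move=> ef /andP[al1 al2] fE.
have f'E := cderiv_exponential ef fE.
have ef' := entire_cderiv_exponential ef f'E.
split=> //; have [cp cq] := cts_parts ef'; have cg := @cts_gaussian R.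
split.
- exact: (continuous_measurable_plane cp).
- exact: (continuous_measurable_plane cq).
pose D := 8 * al ^+ 2 + 2 * (b1 ^+ 2 + b2 ^+ 2).
have PC0 : 0 <= pi^-1 * cabs C ^+ 2 by rewrite mulr_ge0 ?sqr_ge0// invr_ge0 pi_ge0.
have D0 : 0 <= D by rewrite addr_ge0// mulr_ge0// ?addr_ge0 ?sqr_ge0.
have -> : (\int[area R]_z (cabs (cderiv f (toC z)) ^+ 2 * gauss (toC z))%:E =
   \int[area R]_z (normsq (repart (cderiv f)) (impart (cderiv f)) z * gaussian z)%:E)%E.
  by apply: eq_integral => z _; rewrite gauss_toC normsq_parts.
apply: (@gaussian_finite _ (1 - 2 * al) (2 * b1) (1 + 2 * al) (- 2 * b2)
  (pi^-1 * cabs C ^+ 2 * D)).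
- lra.
- lra.
- by rewrite /normsq; cont.
- by move=> z; rewrite mulr_ge0 ?gaussian_ge0// /normsq addr_ge0 ?sqr_ge0.
- exact: (mulr_ge0 PC0 D0).
move=> z.
have -> : normsq (repart (cderiv f)) (impart (cderiv f)) z * gaussian z =
   pi^-1 * cabs C ^+ 2 * (slope1 al b1 z ^+ 2 + slope2 al b2 z ^+ 2) *
   (expR (- (1 - 2 * al) * z.1 ^+ 2 + 2 * b1 * z.1) *
    expR (- (1 + 2 * al) * z.2 ^+ 2 + - 2 * b2 * z.2)).
  rewrite normsq_parts f'E fE cexp_quadratic !cabsM !exprMn.
  have -> : cabs ((2 * al)%:C * toC z + b1 +i* b2) ^+ 2 =
      slope1 al b1 z ^+ 2 + slope2 al b2 z ^+ 2.
    by rewrite cabs_sqr /slope1 /slope2 /toC; simpc.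
  rewrite [cabs (_ +i* _) ^+ 2]cabs_sqr /ex1 /ex2 /gaussian /bell /=.
  have -> : expR (- (1 - 2 * al) * z.1 ^+ 2 + 2 * b1 * z.1) *
    expR (- (1 + 2 * al) * z.2 ^+ 2 + - 2 * b2 * z.2) =
    expR (phi1 al b1 b2 z) ^+ 2 * (expR (- z.1 ^+ 2) * expR (- z.2 ^+ 2)).
    by rewrite [expR (phi1 _ _ _ _) ^+ 2]expr2 -!expRD /phi1; congr expR; ring.
  have CS := cos2Dsin2 (phi2 al b1 b2 z).
  rewrite !exprMn -mulrDr CS mulr1.
  by ring.
have -> : pi^-1 * cabs C ^+ 2 * D *
   ((1 + z.1 ^+ 2) * expR (- (1 - 2 * al) * z.1 ^+ 2 + 2 * b1 * z.1)) *
   ((1 + z.2 ^+ 2) * expR (- (1 + 2 * al) * z.2 ^+ 2 + - 2 * b2 * z.2)) =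
   pi^-1 * cabs C ^+ 2 * (D * ((1 + z.1 ^+ 2) * (1 + z.2 ^+ 2))) *
   (expR (- (1 - 2 * al) * z.1 ^+ 2 + 2 * b1 * z.1) *
    expR (- (1 + 2 * al) * z.2 ^+ 2 + - 2 * b2 * z.2)) by ring.
rewrite ler_wpM2r ?mulr_ge0 ?expR_ge0// ler_wpM2l//.
have slope_le (a b c : R) : (2 * a * c + b) ^+ 2 <= 8 * a ^+ 2 * c ^+ 2 + 2 * b ^+ 2.
  have := sqr_ge0 (2 * a * c - b).
  rewrite sqrrB sqrrD !exprMn mulr2n; lra.
have h1 := slope_le al b1 z.1; have h2 := slope_le al b2 z.2.
have hA : 0 <= al ^+ 2 by exact: sqr_ge0.
have hB : 0 <= b1 ^+ 2 + b2 ^+ 2 by rewrite addr_ge0 ?sqr_ge0.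
have x0 : 0 <= z.1 ^+ 2 by exact: sqr_ge0.
have y0 : 0 <= z.2 ^+ 2 by exact: sqr_ge0.
apply: le_trans (lerD h1 h2) _; rewrite /D.
move: (al ^+ 2) (b1 ^+ 2) (b2 ^+ 2) (z.1 ^+ 2) (z.2 ^+ 2) hA hB x0 y0 => A B1 B2 X Y hA hB x0 y0.
have XY : 0 <= X * Y by rewrite mulr_ge0.
have -> : (8 * A + 2 * (B1 + B2)) * ((1 + X) * (1 + Y)) =
  8 * A * X + 2 * B1 + (8 * A * Y + 2 * B2) +
  (8 * A * (1 + X * Y) + 2 * (B1 + B2) * (X + Y + X * Y)) by ring.
by rewrite lerDl addr_ge0// !mulr_ge0// !addr_ge0.
Qed.

End Exponential.

Theorem corollary8 (R : realType) (f : R[i] -> R[i])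
    (f_fock : fock f) (f_neq0 : exists z : R[i], f z <> 0) :
  ((fock_norm f ^+ 2)%:E <= uncertainty_lhs f)%E /\
  (uncertainty_lhs f = (fock_norm f ^+ 2)%:E <->
   exists (c a b : R) (C : R[i]),
     [/\ 0 < c, C <> 0 &
       forall z : R[i],
         f z = C * cexp (((c - 1) / (2 * (c + 1)))%:C * z ^+ 2
                         + (a +i* (b * c)) / (c + 1)%:C * z)]).
Proof.
have [lf ef] := f_fock.
have div_real (a b d : R) : (a +i* b) / d%:C = (a / d) +i* (b / d).
  by rewrite -fmorphV; simpc.
have slopeE (c a b : R) (w : R[i]) : 0 < c ->
    (2 * ((c - 1) / (2 * (c + 1))))%:C * w + (a / (c + 1) +i* (b * c / (c + 1))) =
    ((c - 1)%:C * w + (a +i* (c * b))) / (c + 1)%:C.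
  move=> c0; rewrite -div_real [RHS]mulrDl [c * b]mulrC; congr (_ + _).
  rewrite mulrAC -fmorphV -rmorphM; congr (_%:C * _).
  by field; rewrite gt_eqF//; lra.
have [f'_fock|f'_nfock] := pselect (fock (cderiv f)).
  have [lf' ef'] := f'_fock.
  split; first exact: fock_uncertainty.
  apply: (iff_trans (fock_uncertainty_eq ef ef' lf lf' f_neq0)); split.
    move=> [c [a [b [c0 ext]]]]; exists c, a, b.
    have [|C fE] := @logarithmic_derivative R f ((c - 1) / (2 * (c + 1))) (a / (c + 1))
        (b * c / (c + 1)) ef.
      move=> w; rewrite slopeE//.
      have c1 : (c + 1)%:C != 0 :> R[i] by rewrite eq_complex/= negb_and gt_eqF// addr_gt0.
      apply: (mulfI c1); rewrite mulrA mulrCA mulfV// mulr1.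
      have := ext w; rewrite [1 + c]addrC => /eqP.
      rewrite addr_eq0 => /eqP ->; rewrite -mulNr; congr (_ * _).
      by rewrite opprB addrC -mulNr -rmorphN opprB.
    exists C; split => // [C0|w]; last by rewrite fE div_real.
    by have [w] := f_neq0; apply; rewrite fE C0 mul0r.
  move=> [c [a [b [C [c0 C0 fE]]]]]; exists c, a, b; split => // w.
  have fE' t : f t = C * cexp (((c - 1) / (2 * (c + 1)))%:C * t ^+ 2 +
     ((a / (c + 1)) +i* (b * c / (c + 1))) * t) by rewrite fE div_real.
  rewrite (cderiv_exponential ef fE') slopeE//.
  have c1 : (c + 1)%:C != 0 :> R[i] by rewrite eq_complex/= negb_and gt_eqF// addr_gt0.
  rewrite [1 + c]addrC mulrA mulrCA mulfV// mulr1 -mulrDl.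
  rewrite [X in X * _](_ : _ = 0) ?mul0r//.
  by rewrite addrACA subrr addr0 -mulrDl -rmorphD addrC addrA subrK subrr mul0r.
(* Both sides of the equivalence are false here. *)
have lhsE : uncertainty_lhs f = +oo%E by rewrite /uncertainty_lhs asboolF.
split; first by rewrite lhsE leey.
rewrite lhsE; move: (fock_norm f ^+ 2) => N.
split=> [//|[c [a [b [C [c0 C0 fE]]]]]]; exfalso; apply: f'_nfock.
apply: (@fock_cderiv_exponential R f ((c - 1) / (2 * (c + 1))) (a / (c + 1))
  (b * c / (c + 1)) C ef); last by move=> t; rewrite fE div_real.
have -> : 2 * ((c - 1) / (2 * (c + 1))) = (c - 1) / (c + 1) by field; rewrite gt_eqF//; lra.
by rewrite ltr_pdivlMr ?ltr_pdivrMr; lra.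
Qed.
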